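(* Let $d\ge2$, $\varrho\ge0$, and let $W$ be a doubling weight on $\mathbb{X}^{d+1}$ such that $W(x,t)=W(x,-t)$ for all $(x,t)\in\mathbb{X}^{d+1}$. Let $n$ be a positive integer, $0<\delta\le1$, and let $\Xi$ be a symmetric maximal $\frac{\delta}{n}$-separated subset of $\mathbb{X}^{d+1}$. (i) For all $0<p<\infty$ and all $f\in\Pi_m^E(\mathbb{X}^{d+1})$ with $n\le m\le cn$, $$\sum_{(z,\tau)\in\Xi}\Big(\max_{(x,t)\in\mathbf{b}_\varrho((z,\tau),\frac{\delta}{n})}|f(x,t)|^p\Big)\,W\big(\mathbf{b}_\varrho((z,\tau),\tfrac{\delta}{n})\big)\le c_{W,p}\,\|f\|_{p,W}^p,$$ where $c_{W,p}$ depends on $p$ when $p$ is close to $0$ and on the doubling constant of $W$. (ii) For $0<r<1$ there is a $\delta_r>0$ such that for $\delta\le\delta_r$, $r\le p<\infty$ and $f\in\Pi_n^E(\mathbb{X}^{d+1})$, $$\|f\|_{p,W}^p\le c_{W,r}\sum_{(z,\tau)\in\Xi}\Big(\min_{(x,t)\in\mathbf{b}_\varrho((z,\tau),\frac{\delta}{n})}|f(x,t)|^p\Big)\,W\big(\mathbf{b}_\varrho((z,\tau),\tfrac{\delta}{n})\big),$$ where $c_{W,r}$ depends only on the doubling constant of $W$ and on $r$ when $r$ is close to $0$.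
   Context: For $\varrho\ge0$, $\mathbb{X}^{d+1}=\{(x,t)\in\mathbb{R}^d\times\mathbb{R}:\|x\|^2\le t^2-\varrho^2,\ \varrho\le|t|\le\sqrt{\varrho^2+1}\}$ (a solid double cone if $\varrho=0$, a solid double hyperboloid if $\varrho>0$), with upper part $\{t\ge0\}$ and lower part $\{t\le0\}$. Distance. For $\varrho=0$ and all $(x,t),(y,s)\in\mathbb{X}^{d+1}$, $$\mathsf{d}_{\mathbb{X}}^0((x,t),(y,s))=\mathsf{d}_{\mathbb{X}}((x,t),(y,s))=\arccos\Big(\langle x,y\rangle+\sqrt{t^2-\|x\|^2}\sqrt{s^2-\|y\|^2}+\sqrt{1-t^2}\sqrt{1-s^2}\Big).$$ For $\varrho>0$ the two parts are disjoint, and for two points both in the upper part or both in the lower part $$\mathsf{d}_{\mathbb{X}}^\varrho((x,t),(y,s))=\arccos\Big(\langle x,y\rangle+\sqrt{t^2-\varrho^2-\|x\|^2}\sqrt{s^2-\varrho^2-\|y\|^2}+\sqrt{1+\varrho^2-t^2}\sqrt{1+\varrho^2-s^2}\Big);$$ for $\varrho>0$ only the distance between points in the same part is considered, and conditions involving the distance refer to such points. The ball is $\mathbf{b}_\varrho((x,t),\rho)=\{(y,s)\in\mathbb{X}^{d+1}:\mathsf{d}_{\mathbb{X}}^\varrho((x,t),(y,s))\le\rho\}$. Weights. For a nonnegative weight $W$, $W(E)=\int_EW\,dx\,dt$ and $\|f\|_{p,W}=\big(\int_{\mathbb{X}^{d+1}}|f|^p\,W\,dx\,dt\big)^{1/p}$.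 The weight is doubling if there is $L>0$ with $W(\mathbf{b}_\varrho(z,2\rho))\le L\,W(\mathbf{b}_\varrho(z,\rho))$ for all $z\in\mathbb{X}^{d+1}$ and $\rho\in(0,r_0)$, where $r_0$ is the largest positive number such that $\mathbf{b}_\varrho(z,\rho)\subset\mathbb{X}^{d+1}$; the smallest such $L$ is the doubling constant. Polynomials. $\Pi_n^E(\mathbb{X}^{d+1})$ is the space of polynomials $p$ of degree at most $n$ in the $d+1$ variables $(x,t)$ with $p(x,t)=p(x,-t)$ for all $(x,t)\in\mathbb{X}^{d+1}$. Point sets. A discrete set $\Xi\subset\mathbb{X}^{d+1}$ is $\varepsilon$-separated if $\mathsf{d}_{\mathbb{X}}^\varrho(z,z')\ge\varepsilon$ for every two distinct points $z,z'\in\Xi$. It is maximal if there is a constant $c_d>1$ with $1\le\sum_{z\in\Xi}\chi_{\mathbf{b}_\varrho(z,\varepsilon)}(y)\le c_d$ for all $y\in\mathbb{X}^{d+1}$, where $\chi_E$ is the characteristic function of $E$. It is (evenly) symmetric if $(0,0)\notin\Xi$ and $\{(z,\tau)\in\Xi:\tau<0\}=\{(-z,-\tau):(z,\tau)\in\Xi,\ \tau>0\}$. In (i), $c$ is a fixed positive constant.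
   Formalization: The constants cannot be independent of p as p→∞ (take W=1, f=t², n=2): in (ii) c_{W,r} is replaced by C^p with C depending only on the doubling constant and r; in (i) c_{W,p} is at most C^p for p≥p_0, for each p_0>0. *)

(* Defs.v *)
From HB Require Import structures.
From mathcomp Require Import all_boot all_order all_algebra.
From mathcomp Require Import all_classical all_reals all_analysis.
From mathcomp Require mpoly.

Set Implicit Arguments.
Unset Strict Implicit.
Unset Printing Implicit Defensive.
Import Order.TTheory GRing.Theory Num.Theory.
Import numFieldNormedType.Exports.
Local Open Scope classical_set_scope.
Local Open Scope ring_scope.

(* R^d is [d.-tuple R], which carries the product Borel sigma-algebra, and a
   point (x, t) of R^d x R is a pair in [d.-tuple R * R]. *)

Section LebesgueTuple.
Variable R : realType.

Local Notation RR := (measurableTypeR R).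

Definition cons_pair n (u : RR * n.-tuple RR) : n.+1.-tuple RR :=
  [tuple of u.1 :: u.2].

Fixpoint lebesgue_tuple n : set (n.-tuple RR) -> \bar R :=
  match n with
  | 0 => \d_([tuple] : 0.-tuple RR)
  | n'.+1 => pushforward
      (product_measure1 (@lebesgue_measure R) (@lebesgue_tuple n'))
      (@cons_pair n')
  end.

Lemma measurable_cons_pair n :
  measurable_fun [set: RR * n.-tuple RR] (@cons_pair n).
Proof. exact: (measurable_cons measurable_fst measurable_snd). Qed.

Lemma measure_lebesgue_tuple n :
  exists m : {sigma_finite_measure set (n.-tuple RR) -> \bar R},
    @lebesgue_tuple n = m.
Proof.
elim: n => [|n [m mE]] /=; first by eexists (\d_([tuple] : 0.-tuple RR)).
rewrite mE.
pose l : {sigma_finite_measure set RR -> \bar R} := @lebesgue_measure R.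
pose pm : {measure set (RR * n.-tuple RR)%type -> \bar R} :=
  product_measure1 l m.
have [F TF mF] : sigma_finite setT pm.
  have /sigma_finiteP[F [TF ndF Foo]] := sigma_finiteT l.
  have /sigma_finiteP[G [TG ndG Goo]] := sigma_finiteT m.
  exists (fun k => F k `*` G k).
    rewrite -setXTT TF TG predeqE => -[x y]; split; last first.
      by move=> [k _ []/= ? ?]; split; exists k.
    move=> [/= [i _ Fx] [k _ Gy]]; exists (maxn i k) => //; split.
      by move: x Fx; exact/subsetPset/ndF/leq_maxl.
    by move: y Gy; exact/subsetPset/ndG/leq_maxr.
  move=> k; have [? ?] := Foo k; have [? ?] := Goo k.
  split; first exact: measurableX.
  by rewrite /pm /= product_measure1E// lte_mul_pinfty// ge0_fin_numE.
pose f := @cons_pair n; have mf := @measurable_cons_pair n : measurable_fun setT f.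
pose q : {measure set (n.+1.-tuple RR) -> \bar R} :=
  measure_function_pushforward__canonical__measure_function_Measure pm mf.
suff sq : sigma_finite setT q.
  pose H := Measure_isSigmaFinite.Build _ _ _ q sq.
  pose q' : {sigma_finite_measure set (n.+1.-tuple RR) -> \bar R} :=
    HB.pack (Measure.sort q) (Measure.class q) H.
  by exists q'.
pose g := fun v : n.+1.-tuple RR => (thead v, [tuple of behead v]).
have fK : cancel f g by move=> [a v]; congr pair; apply/val_inj.
have gK : cancel g f by move=> v; rewrite [RHS](tuple_eta v).
have mg : measurable_fun setT g.
  apply/measurable_fun_pairP; split; first exact: measurable_tnth.
  exact: measurable_behead.
exists (fun i => g @^-1` F i).
  by rewrite -preimage_bigcup -TF preimage_setT.
move=> i; have [mFi Fi] := mF i; split.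
  by rewrite -[X in measurable X]setTI; exact: mg.
rewrite /q /= /pushforward -comp_preimage (_ : g \o f = id) //.
by apply/funext => v; exact: fK.
Qed.

Lemma lebesgue_tuple0 n : @lebesgue_tuple n set0 = 0%E.
Proof. by have [m ->] := measure_lebesgue_tuple n; rewrite measure0. Qed.

Lemma lebesgue_tuple_ge0 n A : (0 <= @lebesgue_tuple n A)%E.
Proof. by have [m ->] := measure_lebesgue_tuple n; rewrite measure_ge0. Qed.

Lemma lebesgue_tuple_semi_sigma_additive n :
  semi_sigma_additive (@lebesgue_tuple n).
Proof.
by have [m ->] := measure_lebesgue_tuple n; exact: measure_semi_sigma_additive.
Qed.

HB.instance Definition _ n := isMeasure.Build _ _ _ (@lebesgue_tuple n)
  (lebesgue_tuple0 n) (@lebesgue_tuple_ge0 n)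
  (@lebesgue_tuple_semi_sigma_additive n).

Lemma sigma_finite_lebesgue_tuple n : sigma_finite setT (@lebesgue_tuple n).
Proof. by have [m ->] := measure_lebesgue_tuple n; exact: sigma_finiteT. Qed.

HB.instance Definition _ n := Measure_isSigmaFinite.Build _ _ _
  (@lebesgue_tuple n) (@sigma_finite_lebesgue_tuple n).

End LebesgueTuple.

(* Only the canonical structures of mpoly are imported: its notations and some
   of its names clash with those of the analysis library. *)
Import (canonicals) mpoly.

Notation pointX R d := (d.-tuple (measurableTypeR R) * measurableTypeR R)%type.

Section DoubleHyperboloid.
Variables (R : realType) (d : nat).

Local Notation RR := (measurableTypeR R).
Local Notation point := (pointX R d).

Definition lebesgue_point : set point -> \bar R :=
  product_measure1 (@lebesgue_tuple R d) (@lebesgue_measure R).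

Definition inner (x y : d.-tuple RR) : R := \sum_(i < d) tnth x i * tnth y i.

Definition flip (z : point) : point := (z.1, - z.2).

Definition antipode (z : point) : point := ([tuple of map -%R z.1], - z.2).

Definition origin : point := ([tuple of nseq d 0], 0).

Variable rho : R.

Definition solid : set point :=
  [set z | inner z.1 z.1 <= z.2 ^+ 2 - rho ^+ 2 /\
           rho <= `|z.2| <= Num.sqrt (rho ^+ 2 + 1)].

(* For rho = 0 the distance is defined on the whole solid double cone (where
   it does not separate (x, t) from (x, -t)); for rho > 0 it is only
   considered between two points of the same part. *)
Definition same_part (z w : point) : Prop :=
  rho = 0 \/ (0 <= z.2 /\ 0 <= w.2) \/ (z.2 <= 0 /\ w.2 <= 0).

Definition distX (z w : point) : R :=
  acos (inner z.1 w.1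
    + Num.sqrt (z.2 ^+ 2 - rho ^+ 2 - inner z.1 z.1)
      * Num.sqrt (w.2 ^+ 2 - rho ^+ 2 - inner w.1 w.1)
    + Num.sqrt (1 + rho ^+ 2 - z.2 ^+ 2) * Num.sqrt (1 + rho ^+ 2 - w.2 ^+ 2)).

Definition ballX (z : point) (r : R) : set point :=
  [set w | solid w /\ same_part z w /\ distX z w <= r].

Definition weightX (W : point -> R) : Prop :=
  measurable_fun solid W /\ forall z, solid z -> 0 <= W z.

Definition weight_of (W : point -> R) (E : set point) : \bar R :=
  (\int[lebesgue_point]_(z in E) (W z)%:E)%E.

Definition wnorm (p : R) (W f : point -> R) : \bar R :=
  ((\int[lebesgue_point]_(z in solid) (`|f z| `^ p * W z)%:E) `^ p^-1)%E.

(* [doubling L W]: W is doubling with doubling constant at most L.  A ball is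
   by definition a subset of [solid], so the radius is not restricted; once
   the ball of radius r is all that the distance from z can reach, the
   inequality only says that 1 <= L (or W is degenerate). *)
Definition doubling (L : R) (W : point -> R) : Prop :=
  forall z r, solid z -> 0 < r ->
    (weight_of W (ballX z (2 * r)) <= L%:E * weight_of W (ballX z r))%E.

Definition even_on_solid (T : Type) (f : point -> T) : Prop :=
  forall z, solid z -> f z = f (flip z).

(* Variables 0, ..., d-1 stand for x, and variable d for t. *)
Definition polyval (p : mpoly.mpoly d.+1 R) (z : point) : R :=
  mpoly.meval (tnth [tuple of rcons z.1 z.2]) p.

Definition PiE (n : nat) (f : point -> R) : Prop :=
  even_on_solid f /\
  exists p : mpoly.mpoly d.+1 R,
    (forall m, m \in mpoly.msupp p -> (mpoly.mdeg m <= n)%N) /\ f = polyval p.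

Definition separatedX (e : R) (Xi : set point) : Prop :=
  Xi `<=` solid /\
  forall z w, Xi z -> Xi w -> z <> w -> same_part z w -> e <= distX z w.

Definition maximalX (e : R) (Xi : set point) : Prop :=
  exists2 c : R, 1 < c & forall y, solid y ->
    (1 <= \esum_(z in Xi) (\1_(ballX z e) y : R)%:E <= c%:E)%E.

Definition symmetric_set (Xi : set point) : Prop :=
  ~ Xi origin /\
  [set z | Xi z /\ z.2 < 0] = antipode @` [set z | Xi z /\ 0 < z.2].

(* The balls are nonempty and compact, so for a polynomial f these are the
   maximum and the minimum of |f|^p over the ball. *)
Definition max_ball (p : R) (f : point -> R) (z : point) (r : R) : \bar R :=
  ereal_sup [set (`|f w| `^ p)%:E | w in ballX z r].

Definition min_ball (p : R) (f : point -> R) (z : point) (r : R) : \bar R :=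
  ereal_inf [set (`|f w| `^ p)%:E | w in ballX z r].

End DoubleHyperboloid.

(* Main.v *)
Require Import Defs.
From HB Require Import structures.
From mathcomp Require Import all_boot all_order all_algebra.
From mathcomp Require Import finmap.
From mathcomp Require Import all_classical all_reals all_analysis.
From mathcomp Require Import measurable_realfun.
From mathcomp Require mpoly.
From mathcomp Require Import ring lra zify.
Set Implicit Arguments.
Unset Strict Implicit.
Unset Printing Implicit Defensive.
Import Order.TTheory GRing.Theory Num.Theory.
Import numFieldNormedType.Exports.
Local Open Scope classical_set_scope.
Local Open Scope ring_scope.

(** Why the theorem is true.  The map sending (x, t) to
    (x, sqrt (t^2 - rho^2 - |x|^2), sqrt (1 + rho^2 - t^2)) carries each part of
    the solid onto the quarter of the unit sphere of R^(d+2) on which the last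
    two coordinates are nonnegative, and turns the distance into the geodesic
    distance.  A polynomial f of degree n that is even in t becomes a polynomial
    of degree n in x and the last coordinate, even in the latter.  It therefore
    makes sense on the whole sphere, is unchanged when the sphere is folded onto
    the quarter, and is a trigonometric polynomial of degree n along every great
    circle.

    All the analysis on the sphere is one-dimensional.  Multiplying a
    trigonometric polynomial T by a power of the normalized Fejer kernel, which
    is 1 at 0, has a critical point there, and decays like (n theta)^(-2), and
    then applying Bernstein's inequality to the product, bounds T'(0) by n times
    the best M in |T(theta)| <= M (1 + n |theta|)^b ([localized_bernstein]).
    Along great circles this says that f varies by at most K n dist(z, w) M
    between z and a point w at distance at most 1/n, as soon as
    |f| <= M (1 + n dist(z, .))^b ([osc_part]).

    From there on only the doubling property matters ([doubling_space]).  Let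
    M_z be, up to a factor 2, the least M as above, and let y be a point that
    nearly determines it.  By the oscillation bound |f| is at least |f(y)| / 2 on a ball
    of radius comparable to 1/m around y, m being the scale.  So M_z^p is at most
    (1 + m dist(z, y))^(-b p) times an average of |f|^p over that ball.  Doubling
    compares the ball with one of radius 2^j / m around z at the price of a
    factor 2^(A j), which the decay absorbs once b p > A, leaving a summable
    factor 2^(-j) ([majorant_le_mean]).  Summing over an e-separated set, the balls
    of radius 2^j / m overlap, but weighted by mu (B(z, e)) / mu (B(z, 2^j / m))
    their overlap is bounded, because balls of radius e / 4 are disjoint and
    doubling compares all the masses ([overlap]).  The result is
    sum_z M_z^p mu (B(z, e)) <= C^p int |f|^p ([sum_majorant_le]).

    Part (i) follows since |f| <= C M_z on B(z, e) ([mz_upper]).  For part (ii)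
    the balls cover, and on B(z, e) the values of |f| differ by at most
    2 K delta M_z; so int |f|^p is at most 2^p times the sum of the minima plus
    a multiple (C delta)^p of int |f|^p, which is absorbed for small delta
    ([mz_lower]).  A weight whose mass is infinite on one ball has infinite mass
    on all of them, and is treated separately. *)

(** * Trigonometric polynomials and a localized Bernstein inequality *)

Section TrigonometricPolynomials.
Variable R : realType.
Implicit Types (T S : R -> R) (n k : nat).

(** The frequencies are integers, not naturals, so that the product-to-sum
    formulas need no case distinction. *)
Inductive trigp n : (R -> R) -> Prop :=
| trigp_cos (k : int) of (`|k| <= n)%N : trigp n (fun t => cos (k%:~R * t))
| trigp_sin (k : int) of (`|k| <= n)%N : trigp n (fun t => sin (k%:~R * t))
| trigpD T S of trigp n T & trigp n S : trigp n (fun t => T t + S t)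
| trigpZ (c : R) T of trigp n T : trigp n (fun t => c * T t).

Lemma trigp_eq n T S : T =1 S -> trigp n T -> trigp n S.
Proof. by move=> /funext ->. Qed.

Lemma trigpW n m T : (n <= m)%N -> trigp n T -> trigp m T.
Proof.
move=> nm; elim=> [k kn|k kn|{}T S _ ? _ ?|c {}T _ ?].
- exact: trigp_cos (leq_trans kn nm).
- exact: trigp_sin (leq_trans kn nm).
- exact: trigpD.
- exact: trigpZ.
Qed.

Lemma trigp_cst n (c : R) : trigp n (fun=> c).
Proof.
have /(trigpZ c) : trigp n (fun t => cos ((0 : int)%:~R * t)) by exact: trigp_cos.
by apply: trigp_eq => t /=; rewrite mul0r cos0 mulr1.
Qed.

Lemma trigp_sum n (I : Type) (s : seq I) (P : pred I) (F : I -> R -> R) :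
  (forall i, P i -> trigp n (F i)) -> trigp n (fun t => \sum_(i <- s | P i) F i t).
Proof.
move=> FP; elim: s => [|i s IH].
  by apply: trigp_eq (trigp_cst n 0) => t; rewrite big_nil.
case Pi : (P i).
  by apply: trigp_eq (trigpD (FP i Pi) IH) => t; rewrite big_cons Pi.
by apply: trigp_eq IH => t; rewrite big_cons Pi.
Qed.

Lemma trigp_cosM n m (k l : int) : (`|k| <= n)%N -> (`|l| <= m)%N ->
  trigp (n + m) (fun t => cos (k%:~R * t) * cos (l%:~R * t)).
Proof.
move=> kn lm.
have h1 : trigp (n + m) (fun t => cos ((k + l)%:~R * t)) by apply: trigp_cos; lia.
have h2 : trigp (n + m) (fun t => cos ((k - l)%:~R * t)) by apply: trigp_cos; lia.
apply: trigp_eq (trigpZ (2^-1) (trigpD h1 h2)) => t /=.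
by rewrite !intrD mulrNz !mulrDl mulNr !cosD cosN sinN; field.
Qed.

Lemma trigp_sinM n m (k l : int) : (`|k| <= n)%N -> (`|l| <= m)%N ->
  trigp (n + m) (fun t => sin (k%:~R * t) * sin (l%:~R * t)).
Proof.
move=> kn lm.
have h1 : trigp (n + m) (fun t => cos ((k - l)%:~R * t)) by apply: trigp_cos; lia.
have h2 : trigp (n + m) (fun t => cos ((k + l)%:~R * t)) by apply: trigp_cos; lia.
apply: trigp_eq (trigpZ (2^-1) (trigpD h1 (trigpZ (-1) h2))) => t /=.
by rewrite !intrD mulrNz !mulrDl mulNr !cosD cosN sinN; field.
Qed.

Lemma trigp_sincosM n m (k l : int) : (`|k| <= n)%N -> (`|l| <= m)%N ->
  trigp (n + m) (fun t => sin (k%:~R * t) * cos (l%:~R * t)).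
Proof.
move=> kn lm.
have h1 : trigp (n + m) (fun t => sin ((k + l)%:~R * t)) by apply: trigp_sin; lia.
have h2 : trigp (n + m) (fun t => sin ((k - l)%:~R * t)) by apply: trigp_sin; lia.
apply: trigp_eq (trigpZ (2^-1) (trigpD h1 h2)) => t /=.
by rewrite !intrD mulrNz !mulrDl mulNr !sinD cosN sinN; field.
Qed.

Lemma trigpM n m T S : trigp n T -> trigp m S ->
  trigp (n + m) (fun t => T t * S t).
Proof.
move=> hT hS; elim: hT => [k kn|k kn|T1 T2 _ h1 _ h2|c T1 _ h].
- elim: hS => [l lm|l lm|S1 S2 _ h1 _ h2|c S1 _ h].
  + exact: trigp_cosM.
  + rewrite addnC; apply: trigp_eq (trigp_sincosM lm kn) => t /=.
    by rewrite mulrC.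
  + by apply: trigp_eq (trigpD h1 h2) => t /=; rewrite mulrDr.
  + by apply: trigp_eq (trigpZ c h) => t /=; rewrite mulrCA.
- elim: hS => [l lm|l lm|S1 S2 _ h1 _ h2|c S1 _ h].
  + exact: trigp_sincosM.
  + exact: trigp_sinM.
  + by apply: trigp_eq (trigpD h1 h2) => t /=; rewrite mulrDr.
  + by apply: trigp_eq (trigpZ c h) => t /=; rewrite mulrCA.
- by apply: trigp_eq (trigpD h1 h2) => t /=; rewrite mulrDl.
- by apply: trigp_eq (trigpZ c h) => t /=; rewrite mulrA.
Qed.

Lemma trigpX n k T : trigp n T -> trigp (k * n) (fun t => T t ^+ k).
Proof.
move=> hT; elim: k => [|k IH].
  by apply: trigp_eq (trigp_cst _ 1) => t; rewrite expr0.
by apply: trigp_eq (trigpM hT IH) => t; rewrite exprS.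
Qed.

Lemma trigp_line (a b : R) : trigp 1 (fun t => cos t * a + sin t * b).
Proof.
have hc : trigp 1 (fun t => cos ((1 : int)%:~R * t)) by exact: trigp_cos.
have hs : trigp 1 (fun t => sin ((1 : int)%:~R * t)) by exact: trigp_sin.
apply: trigp_eq (trigpD (trigpZ a hc) (trigpZ b hs)) => t /=.
by rewrite mul1r; ring.
Qed.

Lemma trigp_shift n T (x : R) : trigp n T -> trigp n (fun t => T (x + t)).
Proof.
elim=> [k kn|k kn|T1 T2 _ h1 _ h2|c T1 _ h].
- have h := trigpD (trigpZ (cos (k%:~R * x)) (trigp_cos kn))
    (trigpZ (- sin (k%:~R * x)) (trigp_sin kn)).
  by apply: trigp_eq h => t /=; rewrite mulrDr cosD; ring.
- have h := trigpD (trigpZ (sin (k%:~R * x)) (trigp_cos kn))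
    (trigpZ (cos (k%:~R * x)) (trigp_sin kn)).
  by apply: trigp_eq h => t /=; rewrite mulrDr sinD; ring.
- exact: trigpD h1 h2.
- exact: trigpZ.
Qed.

(** On trigonometric polynomials of degree less than N this equals the mean over
    a period, so that convolutions can be evaluated as finite sums. *)
Definition mean N T : R := N%:R^-1 * \sum_(j < N) T (pi *+ 2 * j%:R / N%:R).

Lemma meanD N T S : mean N (fun t => T t + S t) = mean N T + mean N S.
Proof. by rewrite /mean big_split mulrDr. Qed.

Lemma meanZ N c T : mean N (fun t => c * T t) = c * mean N T.
Proof. by rewrite /mean -mulr_sumr mulrCA. Qed.

Lemma mean_sum N (I : Type) (s : seq I) (F : I -> R -> R) :
  mean N (fun t => \sum_(i <- s) F i t) = \sum_(i <- s) mean N (F i).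
Proof. by rewrite /mean exchange_big mulr_sumr. Qed.

Lemma mean_le N T S : (forall t, T t <= S t) -> mean N T <= mean N S.
Proof. by move=> h; rewrite /mean ler_wpM2l ?invr_ge0// ler_sum. Qed.

Lemma sum_cos_telescope N (h : R) :
  2 * sin (h / 2) * \sum_(j < N) cos (h * j%:R) =
  sin (h * N%:R - h / 2) + sin (h / 2).
Proof.
elim: N => [|N IH].
  by rewrite big_ord0 !mulr0 sub0r sinN addNr.
rewrite big_ord_recr /= mulrDr IH -[N.+1%:R]natr1.
have -> : h * (N%:R + 1) - h / 2 = h * N%:R + h / 2 by field.
by rewrite sinB sinD; ring.
Qed.

Lemma sum_sin_telescope N (h : R) :
  2 * sin (h / 2) * \sum_(j < N) sin (h * j%:R) =
  cos (h / 2) - cos (h * N%:R - h / 2).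
Proof.
elim: N => [|N IH].
  by rewrite big_ord0 !mulr0 sub0r cosN subrr.
rewrite big_ord_recr /= mulrDr IH -[N.+1%:R]natr1.
have -> : h * (N%:R + 1) - h / 2 = h * N%:R + h / 2 by field.
by rewrite cosB cosD; ring.
Qed.

Lemma cos_sin_2pin n : cos (pi *+ 2 * n%:R) = 1 :> R /\ sin (pi *+ 2 * n%:R) = 0 :> R.
Proof.
elim: n => [|n [hc hs]]; first by rewrite mulr0 cos0 sin0.
rewrite -[n.+1%:R]natr1 mulrDr mulr1.
rewrite (cosD (_ * _)) (sinD (_ * _)) hc hs cos2pi sin2pi.
by split; ring.
Qed.

Lemma mean_freq N (n : nat) : (0 < n < N)%N ->
  mean N (fun t => cos (n%:R * t)) = 0 /\ mean N (fun t => sin (n%:R * t)) = 0.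
Proof.
move=> /andP[n0 nN].
have N0 : (0 < N)%N by exact: leq_trans nN.
have N0' : (N%:R : R) != 0 by rewrite pnatr_eq0 -lt0n.
pose h : R := pi *+ 2 * n%:R / N%:R.
have sh : 2 * sin (h / 2) != 0.
  have -> : h / 2 = pi * (n%:R / N%:R) by rewrite /h -mulr_natr; field.
  rewrite mulf_neq0// lt0r_neq0// sin_gt0_pi//.
  rewrite mulr_gt0 ?pi_gt0 ?divr_gt0 ?ltr0n//=.
  by rewrite -[ltRHS]mulr1 ltr_pM2l ?pi_gt0// ltr_pdivrMr ?ltr0n// mul1r ltr_nat.
have hN : h * N%:R = pi *+ 2 * n%:R by rewrite /h divfK.
have [hc hs] := cos_sin_2pin n.
have E1 : \sum_(j < N) cos (h * j%:R) = 0.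
  apply: (mulfI sh); rewrite sum_cos_telescope mulr0 hN sinB hc hs.
  by ring.
have E2 : \sum_(j < N) sin (h * j%:R) = 0.
  apply: (mulfI sh); rewrite sum_sin_telescope mulr0 hN cosB hc hs.
  by ring.
split; rewrite /mean.
  rewrite (eq_bigr (fun j : 'I_N => cos (h * j%:R))) ?E1 ?mulr0// => j _.
  by congr cos; rewrite /h -mulr_natr; field.
rewrite (eq_bigr (fun j : 'I_N => sin (h * j%:R))) ?E2 ?mulr0// => j _.
by congr sin; rewrite /h -mulr_natr; field.
Qed.

Lemma mean_cos N (k : int) : (`|k| < N)%N ->
  mean N (fun t => cos (k%:~R * t)) = (k == 0)%:R.
Proof.
move=> kN.
have -> : (fun t : R => cos (k%:~R * t)) = (fun t => cos (`|k|%:R * t)).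
  apply/funext => t; case: k {kN} => k //.
  by rewrite NegzE mulrNz abszN mulNr cosN.
have [->|k0] := eqVneq k 0.
  rewrite /mean (eq_bigr (fun=> 1)) => [|j _]; last by rewrite mul0r cos0.
  by rewrite big_const_ord iter_addr_0 mulVf// pnatr_eq0; lia.
by have [] := @mean_freq N `|k|%N; first lia.
Qed.

Lemma mean_sin N (k : int) : (`|k| < N)%N ->
  mean N (fun t => sin (k%:~R * t)) = 0.
Proof.
move=> kN; have [->|k0] := eqVneq k 0.
  rewrite /mean (eq_bigr (fun=> 0)) => [|j _]; last by rewrite mul0r sin0.
  by rewrite big1// mulr0.
have [|_ h] := @mean_freq N `|k|%N; first lia.
case: k kN k0 h => k kN k0 h //.
have := congr1 ( *%R (-1)) h; rewrite mulr0 -meanZ => <-.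
congr mean; apply/funext => t.
by rewrite NegzE mulrNz abszN mulNr sinN mulN1r.
Qed.

(** n times the Fejer kernel: nonnegative, with mean n and value n^2 at 0. *)
Definition fejer n (t : R) : R :=
  \sum_(a < n) \sum_(b < n) cos ((a%:Z - b%:Z)%:~R * t).

Lemma fejer_sqr n t : fejer n t =
  (\sum_(a < n) cos (a%:R * t)) ^+ 2 + (\sum_(a < n) sin (a%:R * t)) ^+ 2.
Proof.
rewrite !expr2 !big_distrlr /= -big_split; apply: eq_bigr => a _ /=.
rewrite -big_split; apply: eq_bigr => b _ /=.
by rewrite intrD mulrNz mulrDl mulNr -!pmulrn cosB.
Qed.

Lemma fejer_ge0 n t : 0 <= fejer n t.
Proof. by rewrite fejer_sqr addr_ge0// sqr_ge0. Qed.

Lemma fejer0 n : fejer n 0 = n%:R ^+ 2.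
Proof.
rewrite fejer_sqr (eq_bigr (fun=> 1)) => [|a _]; last by rewrite mulr0 cos0.
rewrite [X in _ + X ^+ 2]big1 => [|a _]; last by rewrite mulr0 sin0.
by rewrite sumr_const card_ord expr0n addr0.
Qed.

Lemma fejer_le n t : fejer n t <= n%:R ^+ 2.
Proof.
have -> : n%:R ^+ 2 = \sum_(a < n) \sum_(b < n) 1 :> R.
  by rewrite !(sumr_const, card_ord) -natrX -mulrnA mulnn.
by apply: ler_sum => a _; apply: ler_sum => b _; exact: cos_le1.
Qed.

Lemma trigp_fejer n : trigp n (fejer n).
Proof.
apply: trigp_sum => a _; apply: trigp_sum => b _; apply: trigp_cos.
by have := ltn_ord a; have := ltn_ord b; lia.
Qed.

Lemma sum_eqn (n m : nat) : \sum_(b < n) (m == b :> nat)%:R = (m < n)%N%:R :> R.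
Proof.
elim: n => [|n IH]; first by rewrite big_ord0.
rewrite big_ord_recr /= IH -natrD; congr (_%:R); lia.
Qed.

Lemma sum_ltn (n p m : nat) :
  \sum_(a < m) (p + a < n)%N%:R = (minn m (n - p))%:R :> R.
Proof.
elim: m => [|m IH]; first by rewrite big_ord0 min0n.
rewrite big_ord_recr /= IH -natrD; congr (_%:R); lia.
Qed.

(** The lag a - b takes the value - p exactly n - p times: these are the
    triangular Fourier coefficients of the Fejer kernel. *)
Lemma sum_lag (n p : nat) :
  \sum_(a < n) \sum_(b < n) (p%:Z + (a%:Z - b%:Z) == 0)%:R = (n - p)%:R :> R.
Proof.
transitivity (\sum_(a < n) (p + a < n)%N%:R : R).
  apply: eq_bigr => a _; rewrite -sum_eqn; apply: eq_bigr => b _.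
  by congr (_%:R); lia.
by rewrite sum_ltn; congr (_%:R); lia.
Qed.

Lemma mean_cos_fejer N n (p : nat) : (p + n <= N)%N ->
  mean N (fun t => cos (p%:~R * t) * fejer n t) = (n - p)%:R.
Proof.
move=> pN.
pose F (a b : 'I_n) (t : R) := 2^-1 * (cos ((p%:Z + (a%:Z - b%:Z))%:~R * t)
  + cos ((p%:Z + (b%:Z - a%:Z))%:~R * t)).
transitivity (mean N (fun t => \sum_(a < n) \sum_(b < n) F a b t)).
  congr mean; apply/funext => t; rewrite mulr_sumr; apply: eq_bigr => a _.
  rewrite mulr_sumr; apply: eq_bigr => b _; rewrite /F.
  have -> : p%:Z + (b%:Z - a%:Z) = p%:Z - (a%:Z - b%:Z) by lia.
  set l := a%:Z - b%:Z.
  rewrite (intrD _ p%:Z l) (intrB _ p%:Z l) mulrDl mulrBl.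
  by rewrite (cosD (_ * _) (_ * _)) (cosB (_ * _)); field.
rewrite mean_sum (eq_bigr (fun a : 'I_n => \sum_(b < n)
   2^-1 * (((p%:Z + (a%:Z - b%:Z) == 0)%:R : R) + (p%:Z + (b%:Z - a%:Z) == 0)%:R))).
  under eq_bigr do rewrite -mulr_sumr big_split /=.
  rewrite -mulr_sumr big_split /= sum_lag exchange_big /= sum_lag.
  by field.
move=> a _; rewrite mean_sum; apply: eq_bigr => b _.
have := ltn_ord a; have := ltn_ord b => bn an.
by rewrite meanZ meanD !mean_cos//; lia.
Qed.

Lemma mean_sin_fejer N n (p : nat) : (p + n <= N)%N ->
  mean N (fun t => sin (p%:~R * t) * fejer n t) = 0.
Proof.
move=> pN.
pose F (a b : 'I_n) (t : R) := 2^-1 * (sin ((p%:Z + (a%:Z - b%:Z))%:~R * t)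
  + sin ((p%:Z + (b%:Z - a%:Z))%:~R * t)).
transitivity (mean N (fun t => \sum_(a < n) \sum_(b < n) F a b t)).
  congr mean; apply/funext => t; rewrite mulr_sumr; apply: eq_bigr => a _.
  rewrite mulr_sumr; apply: eq_bigr => b _; rewrite /F.
  have -> : p%:Z + (b%:Z - a%:Z) = p%:Z - (a%:Z - b%:Z) by lia.
  set l := a%:Z - b%:Z.
  rewrite (intrD _ p%:Z l) (intrB _ p%:Z l) mulrDl mulrBl.
  by rewrite (sinD (_ * _) (_ * _)) (sinB (_ * _)); field.
rewrite mean_sum big1// => a _; rewrite mean_sum big1// => b _.
have := ltn_ord a; have := ltn_ord b => bn an.
by rewrite meanZ meanD !mean_sin ?addr0 ?mulr0//; lia.
Qed.

Lemma mean_fejer N n : (n <= N)%N -> mean N (fejer n) = n%:R.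
Proof.
move=> nN; rewrite -[in RHS](subn0 n) -(@mean_cos_fejer N)//.
by congr mean; apply/funext => t; rewrite mul0r cos0 mul1r.
Qed.

Lemma is_derive_dilation (c x : R) : is_derive x 1 (fun t => c * t) c.
Proof.
rewrite -[X in is_derive _ _ _ X]mulr1.
exact: (@is_deriveZ _ _ _ id c x 1 1).
Qed.

(** The triangular coefficients of the Fejer kernel, shifted to n and to - n, differ
    by k at every frequency k with |k| <= n; so pairing with the kernel
    2 sin (n t) fejer n t multiplies the amplitude at frequency k by k, as the
    derivative does. *)
Lemma trigp_derive0 n T : trigp n T ->
  is_derive (0 : R) 1 T
    (mean (3 * n) (fun t => T t * (2 * sin (n%:~R * t) * fejer n t))).
Proof.
elim=> [k kn|k kn|T1 T2 _ h1 _ h2|c T1 _ h].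
- have -> : mean (3 * n) (fun t => cos (k%:~R * t) *
      (2 * sin (n%:~R * t) * fejer n t)) = - (sin (k%:~R * 0)) * k%:~R.
    rewrite mulr0 sin0 oppr0 mul0r.
    transitivity (mean (3 * n) (fun t => sin ((absz (n%:Z + k))%:~R * t) * fejer n t
        + sin ((absz (n%:Z - k))%:~R * t) * fejer n t)).
      congr mean; apply/funext => t.
      have -> : absz (n%:Z + k) = n%:Z + k :> int by lia.
      have -> : absz (n%:Z - k) = n%:Z - k :> int by lia.
      rewrite (intrD _ n k) (intrB _ n k) (mulrDl n%:~R) (mulrDl n%:~R) (mulNr k%:~R).
      by rewrite (sinD (_ * _) (_ * _)) (sinB (_ * _)); ring.
    by rewrite meanD !mean_sin_fejer ?addr0//; lia.
  exact: (is_derive1_comp (is_derive_cos _) (is_derive_dilation _ _)).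
- have -> : mean (3 * n) (fun t => sin (k%:~R * t) *
      (2 * sin (n%:~R * t) * fejer n t)) = (cos (k%:~R * 0)) * k%:~R.
    rewrite mulr0 cos0 mul1r.
    transitivity (mean (3 * n) (fun t => cos ((absz (n%:Z - k))%:~R * t) * fejer n t
        + (-1) * (cos ((absz (n%:Z + k))%:~R * t) * fejer n t))).
      congr mean; apply/funext => t.
      have -> : absz (n%:Z + k) = n%:Z + k :> int by lia.
      have -> : absz (n%:Z - k) = n%:Z - k :> int by lia.
      rewrite (intrD _ n k) (intrB _ n k) (mulrDl n%:~R) (mulrDl n%:~R) (mulNr k%:~R).
      by rewrite (cosB (_ * _)) (cosD (_ * _) (_ * _)); ring.
    rewrite meanD meanZ !mean_cos_fejer; [|lia..].
    rewrite mulN1r.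
    suff : Posz (n - absz (n%:Z - k)%R)%N - Posz (n - absz (n%:Z + k)%R)%N = k.
      by move=> e; rewrite -[in RHS]e intrB -!pmulrn.
    lia.
  exact: (is_derive1_comp (is_derive_sin _) (is_derive_dilation _ _)).
- rewrite (_ : mean _ _ = mean (3 * n)
      (fun t => T1 t * (2 * sin (n%:~R * t) * fejer n t)) +
    mean (3 * n) (fun t => T2 t * (2 * sin (n%:~R * t) * fejer n t))).
    exact: is_deriveD.
  by rewrite -meanD; congr mean; apply/funext => t; rewrite mulrDl.
- rewrite (_ : mean _ _ = c *: mean (3 * n)
      (fun t => T1 t * (2 * sin (n%:~R * t) * fejer n t))).
    exact: is_deriveZ.
  by rewrite /GRing.scale /= -meanZ; congr mean; apply/funext => t; rewrite -!mulrA.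
Qed.

(** The kernel representing T'(0) has absolute value at most 2 (fejer n t), whose
    mean is 2 n.  The constant 2 n instead of the sharp n is harmless. *)
Lemma bernstein n T (M : R) : trigp n T -> (forall t, `|T t| <= M) ->
  exists2 v, is_derive (0 : R) 1 T v & `|v| <= 2 * n%:R * M.
Proof.
move=> hT TM; eexists; first exact: trigp_derive0 hT.
have h N S : (forall t, `|S t| <= 2 * M * fejer n t) -> (n <= N)%N ->
    `|mean N S| <= 2 * n%:R * M.
  move=> hS nN; rewrite ler_norml; apply/andP; split.
    rewrite (_ : - _ = mean N (fun t => - (2 * M) * fejer n t)).
      by apply: mean_le => t; have := hS t; rewrite ler_norml mulNr => /andP[].
    by rewrite meanZ mean_fejer//; ring.
  rewrite (_ : 2 * _ * _ = mean N (fun t => (2 * M) * fejer n t)).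
    by apply: mean_le => t; have := hS t; rewrite ler_norml => /andP[].
  by rewrite meanZ mean_fejer//; ring.
apply: h => [t|]; last lia.
rewrite mulrA normrM (ger0_norm (fejer_ge0 _ _)) ler_wpM2r ?fejer_ge0//.
rewrite !normrM (ger0_norm (ler0n _ 2)).
have := TM t; have := sin_max (n%:~R * t).
move: `|T t| `|sin _| (normr_ge0 (T t)) (normr_ge0 (sin (n%:~R * t))) =>
  a b a0 b0 b1 aM.
nra.
Qed.


Lemma trigp_is_derive n T (x : R) : trigp n T -> exists v, is_derive x 1 T v.
Proof.
elim=> [k kn|k kn|T1 T2 _ [v1 h1] _ [v2 h2]|c T1 _ [v h]].
- by eexists; exact: (is_derive1_comp (is_derive_cos _) (is_derive_dilation _ _)).
- by eexists; exact: (is_derive1_comp (is_derive_sin _) (is_derive_dilation _ _)).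
- by exists (v1 + v2); exact: is_deriveD.
- by exists (c *: v); exact: is_deriveZ.
Qed.

Lemma fejer_derive0 n : is_derive (0 : R) 1 (fejer n) 0.
Proof.
have -> : fejer n = \sum_(a < n) \sum_(b < n)
    (fun t => cos ((a%:Z - b%:Z)%:~R * t)).
  by apply/funext => t; rewrite fct_sumE; apply: eq_bigr => a _; rewrite fct_sumE.
have h : is_derive (0 : R) 1 (\sum_(a < n) \sum_(b < n)
    (fun t => cos ((a%:Z - b%:Z)%:~R * t)))
    (\sum_(a < n) \sum_(b < n) (- sin ((a%:Z - b%:Z)%:~R * 0) * (a%:Z - b%:Z)%:~R)).
  apply: is_derive_sum => a; apply: is_derive_sum => b.
  exact: (is_derive1_comp (is_derive_cos _) (is_derive_dilation _ _)).
apply: is_derive_eq h _; rewrite big1// => a _; rewrite big1// => b _.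
by rewrite mulr0 sin0 oppr0 mul0r.
Qed.

(** Where cos x >= 1/2, the mean value theorem gives sin x >= x cos x; elsewhere
    sin x >= 1/2 while x <= 2. *)
Lemma sin_lb (x : R) : 0 <= x <= pi / 2 -> x <= 4 * sin x.
Proof.
move=> /andP[x0 x2].
have x2' : x <= 2 by apply: (le_trans x2); apply: ltW; exact: pihalf_lt2.
have s0 : 0 <= sin x.
  apply: sin_ge0_pi; rewrite x0 (le_trans x2)//.
  by rewrite ler_pdivrMr// ler_peMr// ?pi_ge0 ?ler1n.
have [c2|c2] := leP (1 / 2) (cos x).
  have cs : {within `[0, x], continuous (@sin R)}.
    by apply: continuous_subspaceT => y; exact: continuous_sin.
  have [xc] := MVT_segment x0 (fun y _ => is_derive_sin y) cs.
  rewrite in_itv/= sin0 !subr0 => /andP[xc0 xcx] ->.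
  have : cos x <= cos xc.
    have pi2 : pi / 2 <= pi :> R by have := @pi_ge0 R; lra.
    by rewrite -(cos_norm x) leNgt ltr_cos ?in_itv/= ?ger0_norm -?leNgt//;
      apply/andP; split => //; lra.
  by nra.
have c0 : 0 <= cos x by apply: cos_ge0_pihalf; rewrite x2 andbT; have := @pi_ge0 R; lra.
have := cos2Dsin2 x; nra.
Qed.

Lemma cos_half_angle (x : R) : cos x = 1 - 2 * sin (x / 2) ^+ 2.
Proof.
have {1}-> : x = (x / 2) *+ 2 by rewrite -mulr_natr divfK.
by rewrite cos_mulr2n cos2sin2; ring.
Qed.

Lemma sqr_le_cos (x : R) : 0 <= x <= pi -> x ^+ 2 <= 32 * (1 - cos x).
Proof.
move=> /andP[x0 xpi].
have /sin_lb h : 0 <= x / 2 <= pi / 2 by apply/andP; split; lra.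
rewrite cos_half_angle.
have : (x / 2) ^+ 2 <= (4 * sin (x / 2)) ^+ 2 by rewrite ler_sqr ?nnegrE//; lra.
by lra.
Qed.

(** After multiplication by (2 sin (t / 2))^2 the two sums in [fejer_sqr] telescope
    to a quantity bounded by 4. *)
Lemma fejer_decay n t : fejer n t * (1 - cos t) <= 2.
Proof.
rewrite cos_half_angle.
have h1 := sum_cos_telescope n t; have h2 := sum_sin_telescope n t.
rewrite fejer_sqr.
have E (F : R -> R) : \sum_(a < n) F (a%:R * t) = \sum_(j < n) F (t * j%:R).
  by apply: eq_bigr => j _; rewrite mulrC.
rewrite !E.
set C := \sum_(j < n) cos _ in h1 *; set S := \sum_(j < n) sin _ in h2 *.
set s := sin (t / 2) in h1 h2 *.
suff : (2 * s * C) ^+ 2 + (2 * s * S) ^+ 2 <= 4 by lra.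
rewrite h1 h2; set c := cos (t / 2).
have e1 := cos2Dsin2 (t / 2); have e2 := cos2Dsin2 (t * n%:R - t / 2).
rewrite -/s -/c in e1; move: e2.
set C' := cos (t * n%:R - t / 2); set S' := sin (t * n%:R - t / 2) => e2.
by have := sqr_ge0 (S' - s); have := sqr_ge0 (c + C'); lra.
Qed.

(** The localizing factor: value 1 and derivative 0 at 0, degree n, and decay of
    order (n t)^(-2). *)
Definition jackson n t : R := fejer n t / n%:R ^+ 2.

(** acos (cos t) is the distance of t to the multiples of 2 pi, so this is an
    estimate on the whole line.  The constant is 2 (1 + 64), where 64 comes from
    [sqr_le_cos] and [fejer_decay]. *)
Lemma jackson_decay n t : (0 < n)%N -> 0 <= jackson n t /\
  jackson n t * (1 + n%:R * acos (cos t)) ^+ 2 <= 130.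
Proof.
move=> n0; have N0 : 0 < n%:R ^+ 2 :> R by rewrite exprn_gt0// ltr0n.
have J0 : 0 <= jackson n t by rewrite /jackson divr_ge0// ?fejer_ge0// ltW.
have J1 : jackson n t <= 1 by rewrite /jackson ler_pdivrMr// mul1r fejer_le.
split=> //; set a := acos _.
have c1 : -1 <= cos t <= 1 by rewrite cos_geN1 cos_le1.
have a0 : 0 <= a by exact: acos_ge0.
have hc : cos a = cos t by rewrite acosK// in_itv.
have := @sqr_le_cos a; rewrite a0 acos_lepi// hc => /(_ isT) h.
have JE : jackson n t * n%:R ^+ 2 = fejer n t by rewrite divfK// gt_eqF.
have : jackson n t * (n%:R * a) ^+ 2 <= 64.
  rewrite exprMn mulrA JE; apply: (le_trans (ler_wpM2l (fejer_ge0 n t) h)).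
  by have := fejer_decay n t; lra.
move: (n%:R * a) => b hb.
have : (1 + b) ^+ 2 <= 2 * (1 + b ^+ 2) by have := sqr_ge0 (1 - b); lra.
move=> /(ler_wpM2l J0); lra.
Qed.

(** T and T (jackson n)^k have the same derivative at 0, and the second one is
    bounded by 130^k M and of degree (k + 1) n. *)
Lemma localized_bernstein k n T (M : R) : (0 < n)%N -> trigp n T ->
  (forall t, `|T t| <= M * (1 + n%:R * acos (cos t)) ^+ (2 * k)) ->
  exists2 v, is_derive (0 : R) 1 T v & `|v| <= 2 * (k.+1)%:R * 130 ^+ k * n%:R * M.
Proof.
move=> n0 hT hM; have [v hv] := trigp_is_derive 0 hT.
exists v => //.
have N0 : n%:R ^+ 2 != 0 :> R by rewrite expf_neq0// pnatr_eq0 -lt0n.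
have hJ : trigp n (jackson n).
  by apply: trigp_eq (trigpZ (n%:R ^- 2) (trigp_fejer n)) => t; rewrite mulrC.
have [t|w hw wM] := bernstein (M := 130 ^+ k * M) (trigpM hT (trigpX k hJ)).
  have [J0 J1] := jackson_decay t n0.
  rewrite normrM normrX (ger0_norm J0).
  apply: (le_trans (ler_wpM2r (exprn_ge0 _ J0) (hM t))).
  have M0 : 0 <= M.
    have := hM 0; rewrite cos0 acos1 mulr0 addr0 expr1n mulr1.
    exact: le_trans.
  rewrite exprM -mulrA -exprMn mulrC [(_ ^+ 2) * _]mulrC ler_wpM2r//.
  have P0 := mulr_ge0 J0 (sqr_ge0 (1 + n%:R * acos (cos t))).
  by apply: lerXn2r; rewrite ?nnegrE.
have dJ : is_derive (0 : R) 1 (jackson n) 0.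
  have -> : jackson n = n%:R ^- 2 *: fejer n.
    by apply/funext => t; rewrite /jackson mulrC.
  rewrite -[X in is_derive _ _ _ X](scaler0 _ (n%:R ^- 2)).
  exact: is_deriveZ (fejer_derive0 n).
have J0 : jackson n 0 = 1 by rewrite /jackson fejer0 divff.
have hvw : v = w.
  have h1 := @is_deriveX _ _ (jackson n) k (0 : R) 1 0 dJ.
  have h2 := @is_deriveM _ _ T (jackson n ^+ k) (0 : R) 1 v _ hv h1.
  have E : T * jackson n ^+ k = (fun t => T t * jackson n t ^+ k).
    apply/funext => t; rewrite /GRing.mul /=; congr (_ * _).
    by elim: (k) => [//|j IH]; rewrite !exprS -IH.
  rewrite E in h2.
  have [_ <-] := hw; have [_ ->] := h2.
  have -> : (jackson n ^+ k) 0 = 1.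
    by elim: (k) => [//|j IH]; rewrite exprS /GRing.mul /= IH J0 mulr1.
  by rewrite /GRing.scale /= !mulr0 add0r mul1r.
rewrite hvw; apply: (le_trans wM).
by rewrite -mulSn natrM le_eqVlt; apply/orP; left; apply/eqP; ring.
Qed.

Lemma acos_le (c b : R) : -1 <= c <= 1 -> 0 <= b <= pi -> cos b <= c -> acos c <= b.
Proof.
move=> hc hb; rewrite -[X in _ <= X -> _](acosK (_ : c \in `[(-1), 1])) ?in_itv//.
by rewrite leNgt ltr_cos ?in_itv/= ?acos_ge0 ?acos_lepi// -leNgt.
Qed.

(** Triangle inequality on the circle. *)
Lemma acos_cosD (x t : R) : 0 <= x -> acos (cos (x + t)) <= x + acos (cos t).
Proof.
move=> x0; set a := acos (cos t).
have c1 : -1 <= cos t <= 1 by rewrite cos_geN1 cos_le1.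
have c2 : -1 <= cos (x + t) <= 1 by rewrite cos_geN1 cos_le1.
have a0 : 0 <= a by exact: acos_ge0.
have [xa|xa] := leP pi (x + a); first exact: (le_trans (acos_lepi c2)).
apply: acos_le => //; first by rewrite (addr_ge0 x0 a0) ltW.
have ha : cos a = cos t by rewrite acosK// in_itv.
have sx : 0 <= sin x by apply: sin_ge0_pi; apply/andP; split; lra.
have sa : 0 <= sin a by apply: sin_ge0_pi; apply/andP; split; lra.
have := cos2Dsin2 a; have := cos2Dsin2 t; rewrite ha => e1 e2.
have : sin t <= sin a by rewrite leNgt; apply/negP; nra.
by rewrite !cosD ha; nra.
Qed.

Definition osc_cst k : R := 2 * (k.+1)%:R * 130 ^+ k * 4 ^+ k.

Lemma osc_cst_ge0 k : 0 <= osc_cst k.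
Proof. by rewrite /osc_cst !mulr_ge0// exprn_ge0. Qed.

(** By the mean value theorem it is enough to bound the derivative on [0, h].
    At x <= 1 / n the growth hypothesis still holds around x, with 4^k M in place
    of M. *)
Lemma trigp_osc k n T (M h : R) : (0 < n)%N -> trigp n T ->
  (forall t, `|T t| <= M * (1 + n%:R * acos (cos t)) ^+ (2 * k)) ->
  0 <= h -> n%:R * h <= 1 ->
  `|T h - T 0| <= osc_cst k * n%:R * h * M.
Proof.
move=> n0 hT hM h0 nh.
have M0 : 0 <= M.
  by have := hM 0; rewrite cos0 acos1 mulr0 addr0 expr1n mulr1; exact: le_trans.
have der (x : R) : exists v, is_derive x 1 T v /\
    (0 <= x <= h -> `|v| <= osc_cst k * n%:R * M).
  have [v hv] := trigp_is_derive x hT; exists v; split=> // /andP[x0 xh].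
  have [t|w hw wM] := @localized_bernstein k n (fun t => T (x + t)) (4 ^+ k * M)
      n0 (trigp_shift x hT).
    apply: (le_trans (hM _)); rewrite [4 ^+ k * M]mulrC -mulrA ler_wpM2l//.
    rewrite (exprM _ 2 k) (exprM _ 2 k) -exprMn.
    have a0 : 0 <= acos (cos t) by rewrite acos_ge0// cos_geN1 cos_le1.
    have b0 : 0 <= acos (cos (x + t)) by rewrite acos_ge0// cos_geN1 cos_le1.
    have ab := acos_cosD t x0.
    have N0 : 0 <= n%:R :> R by [].
    have H1 : 0 <= 1 + n%:R * acos (cos (x + t)) by rewrite addr_ge0// mulr_ge0.
    have H2 : 1 + n%:R * acos (cos (x + t)) <= 2 * (1 + n%:R * acos (cos t)).
      have := ler_wpM2l N0 ab; have := ler_wpM2l N0 xh.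
      have := mulr_ge0 N0 a0; rewrite mulrDr; lra.
    have H3 : (1 + n%:R * acos (cos (x + t))) ^+ 2 <=
        (2 * (1 + n%:R * acos (cos t))) ^+ 2.
      by apply: lerXn2r; rewrite ?nnegrE ?(le_trans H1 H2).
    apply: lerXn2r; rewrite ?nnegrE ?sqr_ge0//.
      by rewrite mulr_ge0 ?sqr_ge0.
    by apply: (le_trans H3); rewrite exprMn -natrX.
  have hx : is_derive (0 : R) 1 (fun t => x + t) 1.
    by rewrite -[X in is_derive _ _ _ X]add0r; exact: is_deriveD.
  have hv' : is_derive (x + 0) 1 T v by rewrite addr0.
  have h1 := is_derive1_comp hv' hx.
  have -> : v = w.
    by have [_ <-] := hw; have [_ ->] := h1; rewrite mulr1.
  apply: (le_trans wM); rewrite le_eqVlt; apply/orP; left; apply/eqP.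
  by rewrite /osc_cst; ring.
have [df hdf] := choice der.
have cT : {within `[0, h], continuous T}.
  apply: continuous_subspaceT => y.
  by apply/differentiable_continuous/derivable1_diffP; have [[]] := hdf y.
have [c cc ->] := MVT_segment h0 (fun y _ => (hdf y).1) cT.
move: cc; rewrite in_itv/= subr0 normrM (ger0_norm h0) => /(hdf c).2 hc.
rewrite [leRHS](_ : _ = osc_cst k * n%:R * M * h); last by ring.
exact: ler_wpM2r.
Qed.

End TrigonometricPolynomials.

(** * Sums of integrals over overlapping balls *)

Section WeightedSums.
Context {dsp : measure_display} {T : measurableType dsp} {R : realType}.
Variable mu : {measure set T -> \bar R}.
Implicit Types (h W f : T -> R) (E P : set T) (s : seq T).

Lemma ge0_integral_weighted_sum P h s (a : T -> R) (B : T -> set T) :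
  measurable P -> measurable_fun P h -> (forall x, P x -> 0 <= h x) ->
  (forall z, 0 <= a z) -> (forall z, measurable (B z)) ->
  (\int[mu]_(x in P) ((\sum_(z <- s) a z * \1_(B z) x) * h x)%:E =
   \sum_(z <- s) (a z)%:E * \int[mu]_(x in P `&` B z) (h x)%:E)%E.
Proof.
move=> mP mh h0 a0 mB.
have meh : measurable_fun P (fun x => (h x)%:E) by exact/measurable_EFinP.
transitivity (\int[mu]_(x in P)
    (\sum_(z <- s) (a z)%:E * (((fun x => (h x)%:E) \_ (B z)) x)))%E.
  apply: eq_integral => x _; rewrite mulr_suml -sumEFin; apply: eq_bigr => z _.
  by rewrite epatch_indic/= -mulrA [_ * h x]mulrC !EFinM.
rewrite ge0_integral_sum//; last 2 first.
- move=> z; apply: measurable_funeM.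
  rewrite (_ : _ \_ _ = fun x => (h x)%:E * (\1_(B z) x)%:E)%E; last first.
    by apply/funext => x; rewrite epatch_indic.
  apply: emeasurable_funM => //; apply/measurable_EFinP.
  exact: measurable_indic.
- move=> z x Px; rewrite epatch_indic/= -!EFinM lee_fin.
  by rewrite !mulr_ge0 ?h0.
apply: eq_bigr => z _; rewrite integral_mkcondr ge0_integralZl//.
- rewrite (_ : _ \_ _ = fun x => (h x)%:E * (\1_(B z) x)%:E)%E; last first.
    by apply/funext => x; rewrite epatch_indic.
  apply: emeasurable_funM => //; apply/measurable_EFinP.
  exact: measurable_indic.
- by move=> x Px; rewrite epatch_indic/= -EFinM lee_fin mulr_ge0 ?h0.
- by rewrite lee_fin.
Qed.

(** Integrals over overlapping sets add up to at most the total integral times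
    the maximal weighted overlap. *)
Lemma sum_integral_le P h s (a : T -> R) (B : T -> set T) (C : R) :
  measurable P -> measurable_fun P h -> (forall x, P x -> 0 <= h x) ->
  (forall z, 0 <= a z) -> (forall z, measurable (B z)) -> 0 <= C ->
  (forall x, P x -> \sum_(z <- s) a z * \1_(B z) x <= C) ->
  (\sum_(z <- s) (a z)%:E * \int[mu]_(x in P `&` B z) (h x)%:E <=
   C%:E * \int[mu]_(x in P) (h x)%:E)%E.
Proof.
move=> mP mh h0 a0 mB C0 hC; rewrite -ge0_integral_weighted_sum//.
have meh : measurable_fun P (fun x => (h x)%:E) by exact/measurable_EFinP.
rewrite -ge0_integralZl//.
apply: ge0_le_integral => //.
- move=> x Px; rewrite lee_fin mulr_ge0 ?h0// sumr_ge0// => z _.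
  by rewrite mulr_ge0.
- apply/measurable_EFinP; apply: measurable_funM => //.
  by apply: measurable_sum => z; apply: measurable_funM.
- by apply: measurable_funeM.
- by move=> x Px; rewrite -EFinM lee_fin ler_wpM2r ?h0 ?hC.
Qed.

Lemma integral_le_sum P h s (B : T -> set T) :
  measurable P -> measurable_fun P h -> (forall x, P x -> 0 <= h x) ->
  (forall z, measurable (B z)) ->
  (forall x, P x -> exists2 z, z \in s & B z x) ->
  (\int[mu]_(x in P) (h x)%:E <=
   \sum_(z <- s) \int[mu]_(x in P `&` B z) (h x)%:E)%E.
Proof.
move=> mP mh h0 mB hs.
have := @ge0_integral_weighted_sum P h s (fun=> 1) B mP mh h0 (fun=> ler01) mB.
under [in X in _ = X -> _]eq_bigr do rewrite mul1e.
move=> <-; have meh : measurable_fun P (fun x => (h x)%:E) by exact/measurable_EFinP.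
apply: ge0_le_integral => //.
- apply/measurable_EFinP; apply: measurable_funM => //.
  by apply: measurable_sum => z; apply: measurable_funM.
- move=> x Px; rewrite lee_fin ler_peMl ?h0//.
  have [z zs Bz] := hs x Px.
  rewrite (big_rem z)//= mul1r indicE mem_set// lerDl.
  by rewrite sumr_ge0// => y _; rewrite mul1r.
Qed.

End WeightedSums.

(** * Doubling spaces and weighted Peetre majorants *)

Section DoublingSpaces.
Context {dsp : measure_display} {T : measurableType dsp} {R : realType}.
Variable mu : {measure set T -> \bar R}.
Variables (P : set T) (dd : T -> T -> R).

(** The centre is required to lie in P, so that every cball is measurable, with
    no condition on the centre. *)
Definition cball (z : T) (r : R) : set T := [set w | [/\ P z, P w & dd z w <= r]].

(** The constant is written 2^A so that comparing balls whose radii differ by a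
    factor 2^k costs 2^(A k).  The diameter bound 4 stands for pi. *)
Record doubling_space (W : T -> R) (A : nat) : Prop := DoublingSpace {
  ds_measurable : measurable P;
  ds_cball : forall z r, measurable (cball z r);
  ds_ge0 : forall z w, P z -> P w -> 0 <= dd z w;
  ds_refl : forall z, P z -> dd z z = 0;
  ds_sym : forall z w, P z -> P w -> dd z w = dd w z;
  ds_triangle : forall z y w, P z -> P y -> P w -> dd z w <= dd z y + dd y w;
  ds_diam : forall z w, P z -> P w -> dd z w <= 4;
  ds_weight : measurable_fun P W;
  ds_weight_ge0 : forall z, P z -> 0 <= W z;
  ds_doubling : forall z r, P z -> 0 < r ->
    (\int[mu]_(x in cball z (2 * r)) (W x)%:E <=
     (2 ^+ A)%:E * \int[mu]_(x in cball z r) (W x)%:E)%E }.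

Variables (W : T -> R) (A : nat).
Hypothesis dsW : doubling_space W A.

Let mP := ds_measurable dsW.
Let mB := ds_cball dsW.
Let W0 := ds_weight_ge0 dsW.
Let dd0 := ds_ge0 dsW.
Let ddC := ds_sym dsW.
Let ddt := ds_triangle dsW.

Lemma cball_sub z r : cball z r `<=` P.
Proof. by move=> w []. Qed.

Lemma cball_subset z w r s : P z -> P w -> dd z w + r <= s ->
  cball w r `<=` cball z s.
Proof.
move=> Pz Pw h y [_ Py wy]; split=> //.
by apply: le_trans (ddt Pz Pw Py) _; apply: le_trans h; rewrite lerD2l.
Qed.

Lemma cball_full z r : P z -> 4 <= r -> cball z r = P.
Proof.
move=> Pz r4; apply/seteqP; split=> [w []//|w Pw]; split=> //.
exact: le_trans (ds_diam dsW Pz Pw) r4.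
Qed.

Lemma mass_ge0 (E : set T) : E `<=` P -> (0 <= \int[mu]_(x in E) (W x)%:E)%E.
Proof. by move=> EP; apply: integral_ge0 => x /EP/W0; rewrite lee_fin. Qed.

Lemma mass_mono (E F : set T) : measurable E -> measurable F ->
  F `<=` P -> E `<=` F ->
  (\int[mu]_(x in E) (W x)%:E <= \int[mu]_(x in F) (W x)%:E)%E.
Proof.
move=> mE mF FP EF; apply: ge0_subset_integral => //.
  by apply/measurable_EFinP; apply: measurable_funS (ds_weight dsW).
by move=> x /FP/W0; rewrite lee_fin.
Qed.

Lemma mass_doubling k z r : P z -> 0 < r ->
  (\int[mu]_(x in cball z (2 ^+ k * r)) (W x)%:E <=
   (2 ^+ (A * k))%:E * \int[mu]_(x in cball z r) (W x)%:E)%E.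
Proof.
move=> Pz r0; elim: k => [|k IH].
  by rewrite muln0 !expr0 !mul1r mul1e.
have h : 0 < 2 ^+ k * r by rewrite mulr_gt0 ?exprn_gt0.
have := ds_doubling dsW Pz h; rewrite mulrA -exprS => /le_trans; apply.
rewrite mulnS exprD EFinM -muleA.
by apply: lee_pmul => //; rewrite ?lee_fin ?exprn_ge0// mass_ge0//; exact: cball_sub.
Qed.

Hypothesis finW : (\int[mu]_(x in P) (W x)%:E < +oo)%E.

Definition vol (z : T) (r : R) : R := fine (\int[mu]_(x in cball z r) (W x)%:E).

Lemma volE z r : (\int[mu]_(x in cball z r) (W x)%:E)%E = (vol z r)%:E.
Proof.
rewrite fineK// ge0_fin_numE ?mass_ge0//; last exact: cball_sub.
apply: le_lt_trans finW; apply: mass_mono => //; exact: cball_sub.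
Qed.

Lemma vol_ge0 z r : 0 <= vol z r.
Proof. by rewrite -lee_fin -volE mass_ge0//; exact: cball_sub. Qed.

Lemma vol_le z w r s : P z -> P w -> dd z w + r <= s -> vol w r <= vol z s.
Proof.
move=> Pz Pw h; rewrite -lee_fin -!volE; apply: mass_mono => //.
  exact: cball_sub.
exact: cball_subset.
Qed.

Lemma vol_le1 z r s : P z -> r <= s -> vol z r <= vol z s.
Proof. by move=> Pz rs; apply: vol_le; rewrite // (ds_refl dsW)// add0r. Qed.

Lemma vol_doubling k z r : P z -> 0 < r ->
  vol z (2 ^+ k * r) <= 2 ^+ (A * k) * vol z r.
Proof. by move=> Pz r0; rewrite -lee_fin EFinM -!volE mass_doubling. Qed.

Definition separated_seq (e : R) (s : seq T) : Prop :=
  forall z w, z \in s -> w \in s -> z <> w -> e <= dd z w.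

(** Balls of radius e / 4 around e-separated points are disjoint. *)
Lemma packing (e r : R) (w : T) (s : seq T) :
  uniq s -> separated_seq e s -> {in s, forall z, P z} -> 0 < e -> P w ->
  {in s, forall z, dd w z + e / 4 <= r} ->
  \sum_(z <- s) vol z (e / 4) <= vol w r.
Proof.
move=> us sep sP e0 Pw hr.
have C x : cball w r x -> \sum_(z <- s) 1 * \1_(cball z (e / 4)) x <= 1 :> R.
  move=> [_ Px _].
  have [[z zs zx]|] := pselect (exists2 z, z \in s & cball z (e / 4) x).
    rewrite (big_rem z)//= big_seq big1 ?addr0 ?mul1r ?indicE ?mem_set// => y.
    rewrite (mem_rem_uniq z us) inE => /andP[/eqP yz ys].
    rewrite indicE memNset ?mulr0// => -[_ _ yx].
    have := sep _ _ ys zs yz; apply/negP; rewrite -ltNge.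
    apply: le_lt_trans (ddt (sP y ys) Px (sP z zs)) _.
    case: zx => _ _; rewrite ddC//; last exact: sP.
    by move: yx; lra.
  move=> h; rewrite big_seq big1// => z zs; rewrite indicE memNset ?mulr0// => zx.
  by apply: h; exists z.
have := @sum_integral_le _ _ _ mu (cball w r) W s (fun=> 1)
  (fun z => cball z (e / 4)) 1 (mB _ _) (measurable_funS mP (@cball_sub _ _)
  (ds_weight dsW)) (fun x h => W0 (cball_sub h)) (fun=> ler01) (fun z => mB _ _)
  ler01 C.
rewrite mul1e volE -lee_fin -sumEFin; apply: le_trans.
rewrite big_seq [leRHS]big_seq; apply: lee_sum => z zs.
rewrite mul1e -volE (_ : cball w r `&` _ = cball z (e / 4))//.
by apply/setIidPr; apply: cball_subset => //; [exact: sP|exact: hr].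
Qed.

(** Points of s at distance at most r of w have balls of radius r with mass
    comparable to vol w r, and the disjoint balls of radius e / 4 around them
    fit into a ball of radius comparable to r around w. *)
Lemma overlap (q : nat) (e r : R) (w : T) (s : seq T) :
  uniq s -> separated_seq e s -> {in s, forall z, P z} -> 0 < e -> 0 < r -> P w ->
  e <= 2 ^+ q * r ->
  \sum_(z <- s) (vol z e / vol z r) * \1_(cball z r) w <= 2 ^+ (A * (q + 4)).
Proof.
move=> us sep sP e0 r0 Pw eq.
have e40 : 0 < e / 4 by rewrite divr_gt0.
have q1 : 1 <= 2 ^+ q :> R by rewrite exprn_ege1// ler1n.
(* in a space of mass 0 the quotients are 0 by convention *)
have [V0|V0] := eqVneq (vol w r) 0.
  rewrite big_seq big1 ?exprn_ge0// => z zs; have Pz := sP z zs.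
  have [[_ _ zw]|zw] := pselect (cball z r w); last by rewrite indicE memNset// mulr0.
  suff -> : vol z r = 0 by rewrite invr0 mulr0 mul0r.
  apply/eqP; rewrite eq_le vol_ge0 andbT.
  have -> : 0 = 2 ^+ (A * 1) * vol w r by rewrite V0 mulr0.
  apply: le_trans (vol_doubling _ _ _) => //; apply: vol_le => //.
  by rewrite ddC//; lra.
have Vw : 0 < vol w r by rewrite lt0r V0 vol_ge0.
pose s' := [seq z <- s | `[< cball z r w >]].
apply: (@le_trans _ _ (\sum_(z <- s') 2 ^+ (A * 3) / vol w r * vol z (e / 4))).
  rewrite big_filter [leRHS]big_mkcond /= big_seq [leRHS]big_seq.
  apply: ler_sum => z zs; have Pz := sP z zs; rewrite indicE.
  case: asboolP => [[_ _ zw]|zw]; last by rewrite memNset// mulr0.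
  rewrite mem_set// mulr1.
  have h1 : vol w r <= 2 ^+ (A * 1) * vol z r.
    apply: le_trans (vol_doubling _ _ _) => //; apply: vol_le => //.
    by lra.
  have h2 : vol z e <= 2 ^+ (A * 2) * vol z (e / 4).
    apply: le_trans (vol_doubling _ _ _) => //; apply: vol_le1 => //.
    by rewrite -natrX; lra.
  have Vz : 0 < vol z r.
    by have := lt_le_trans Vw h1; rewrite pmulr_rgt0// exprn_gt0.
  rewrite mulrAC ler_pdivlMr// mulrAC ler_pdivrMr//.
  have -> : (A * 3 = A * 2 + A * 1)%N by rewrite -mulnDr.
  rewrite exprD (_ : _ * _ * _ * _ = 2 ^+ (A * 2) * vol z (e / 4) *
    (2 ^+ (A * 1) * vol z r)); last by ring.
  by apply: ler_pM => //; exact: vol_ge0.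
rewrite -mulr_sumr.
have : \sum_(z <- s') vol z (e / 4) <= vol w (2 ^+ q.+1 * r).
  apply: packing => //; first exact: filter_uniq.
  - by move=> z y; rewrite !mem_filter => /andP[_ zs] /andP[_ ys]; exact: sep.
  - by move=> z; rewrite mem_filter => /andP[_]; exact: sP.
  - move=> z; rewrite mem_filter => /andP[/asboolP[Pz _ zw] zs].
    by rewrite ddC// exprS; nra.
move=> /le_trans /(_ (vol_doubling _ Pw r0)) h.
apply: (le_trans (ler_wpM2l _ h)); first by rewrite divr_ge0 ?exprn_ge0 ?vol_ge0.
rewrite [leLHS](_ : _ = 2 ^+ (A * 3) * 2 ^+ (A * q.+1)); last by field.
by rewrite -exprD -mulnDr (addnC q).
Qed.

(** The minimality clause bounds j uniformly over a bounded range of x. *)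
Lemma dyadic_scale (x : R) : 0 <= x -> exists j : nat,
  [/\ x <= 2 ^+ j, 2 ^+ j <= 2 * (1 + x) & forall J, x <= 2 ^+ J -> (j <= J)%N].
Proof.
move=> x0; have ex : exists j, x <= 2 ^+ j.
  exists (Num.truncn x).+1; have /ltW := truncnS_gt x; move=> /le_trans; apply.
  by rewrite -natrX ler_nat ltnW// ltn_expl.
exists (ex_minn ex); case: ex_minnP => j xj jmin; split=> //.
case: j xj jmin => [|j] xj jmin; first by rewrite expr0; lra.
have : 2 ^+ j < x by rewrite ltNge; apply/negP => /jmin; rewrite ltnn.
by rewrite exprS; lra.
Qed.

(** The weighted supremum of |f| around z, a Peetre maximal function, need not be
    attained; a point reaching half of it is enough. *)
Lemma near_maximizer (m : R) (b : nat) (f : T -> R) (B : R) z :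
  0 <= m -> P z -> (forall w, P w -> `|f w| <= B) ->
  exists2 y, P y & forall w, P w ->
    `|f w| <= 2 * `|f y| / (1 + m * dd z y) ^+ b * (1 + m * dd z w) ^+ b.
Proof.
move=> m0 Pz fB.
have D1 w : P w -> 1 <= (1 + m * dd z w) ^+ b.
  by move=> Pw; rewrite exprn_ege1// lerDl mulr_ge0// dd0.
have D0 w : P w -> 0 < (1 + m * dd z w) ^+ b.
  by move=> Pw; exact: lt_le_trans ltr01 (D1 w Pw).
pose S := [set `|f w| / (1 + m * dd z w) ^+ b | w in P].
have hS : has_sup S.
  split; first by exists (`|f z| / (1 + m * dd z z) ^+ b), z.
  exists B => _ [w Pw <-]; apply: le_trans (fB w Pw).
  by rewrite ler_pdivrMr ?D0// ler_peMr ?D1.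
have ub w : P w -> `|f w| / (1 + m * dd z w) ^+ b <= sup S.
  by move=> Pw; apply: sup_upper_bound => //; exists w.
have [S0|S0] := leP (sup S) 0.
  exists z => // w Pw; have := le_trans (ub w Pw) S0.
  rewrite ler_pdivrMr ?D0// mul0r => /le_trans; apply.
  by rewrite !mulr_ge0// ?invr_ge0 ltW// D0.
have [_ [y Py <-] yS] := @sup_adherent _ S (sup S / 2) (divr_gt0 S0 (ltr0Sn _ 1)) hS.
exists y => // w Pw; rewrite -ler_pdivrMr ?D0//.
by apply: le_trans (ub w Pw) _; rewrite -mulrA; lra.
Qed.

(** The only property of the function f that is used in a doubling space: a
    Bernstein inequality at scale 1 / m in terms of a Peetre majorant of f at z. *)
Definition osc_bound (m K : R) (b : nat) (f : T -> R) : Prop :=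
  forall z M, P z -> (forall w, P w -> `|f w| <= M * (1 + m * dd z w) ^+ b) ->
  forall w, P w -> m * dd z w <= 1 -> `|f w - f z| <= K * (m * dd z w) * M.

Section PowerIntegrals.
Variables (f : T -> R) (B p : R).
Hypotheses (mf : measurable_fun P f) (fB : forall w, P w -> `|f w| <= B).
Hypothesis p0 : 0 < p.

Lemma measurable_power : measurable_fun P (fun x => `|f x| `^ p * W x).
Proof.
apply: measurable_funM; last exact: ds_weight dsW.
apply: (measurableT_comp (f := fun x => x `^ p)); first exact: measurable_powR.
by apply: measurableT_comp.
Qed.

Lemma power_ge0 x : P x -> 0 <= `|f x| `^ p * W x.
Proof. by move=> Px; rewrite mulr_ge0 ?powR_ge0 ?W0. Qed.

Lemma power_int_le (E : set T) (c : R) : measurable E -> E `<=` P -> 0 <= c ->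
  (forall x, E x -> `|f x| `^ p <= c) ->
  (\int[mu]_(x in E) (`|f x| `^ p * W x)%:E <=
   c%:E * \int[mu]_(x in E) (W x)%:E)%E.
Proof.
move=> mE EP c0 fc.
have mW : measurable_fun E (fun x => (W x)%:E).
  by apply/measurable_EFinP; apply: measurable_funS (ds_weight dsW).
rewrite -ge0_integralZl//; last first.
  by move=> x /EP Px; rewrite lee_fin W0.
apply: ge0_le_integral => //.
- by move=> x /EP Px; rewrite lee_fin power_ge0.
- by apply/measurable_EFinP; apply: measurable_funS measurable_power.
- by apply: measurable_funeM.
- move=> x Ex; rewrite -EFinM lee_fin ler_wpM2r ?W0//; first exact: EP.
  exact: fc.
Qed.

Lemma power_int_ge (E : set T) (c : R) : measurable E -> E `<=` P -> 0 <= c ->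
  (forall x, E x -> c <= `|f x|) ->
  ((c `^ p)%:E * \int[mu]_(x in E) (W x)%:E <=
   \int[mu]_(x in E) (`|f x| `^ p * W x)%:E)%E.
Proof.
move=> mE EP c0 fc.
have mW : measurable_fun E (fun x => (W x)%:E).
  by apply/measurable_EFinP; apply: measurable_funS (ds_weight dsW).
rewrite -ge0_integralZl ?lee_fin ?powR_ge0//; last first.
  by move=> x /EP Px; rewrite lee_fin W0.
apply: ge0_le_integral => //.
- by move=> x /EP Px; rewrite -EFinM lee_fin mulr_ge0 ?powR_ge0 ?W0.
- by apply: measurable_funeM.
- by apply/measurable_EFinP; apply: measurable_funS measurable_power.
- move=> x Ex; rewrite -EFinM lee_fin ler_wpM2r ?W0//; first exact: EP.
  by apply: ge0_ler_powR; rewrite ?nnegrE ?fc// ltW.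
Qed.

Lemma power_int_mono (E F : set T) : measurable E -> measurable F ->
  F `<=` P -> E `<=` F ->
  (\int[mu]_(x in E) (`|f x| `^ p * W x)%:E <=
   \int[mu]_(x in F) (`|f x| `^ p * W x)%:E)%E.
Proof.
move=> mE mF FP EF; apply: ge0_subset_integral => //.
  by apply/measurable_EFinP; apply: measurable_funS measurable_power.
by move=> x /FP Px; rewrite lee_fin power_ge0.
Qed.

Lemma power_int_fin (E : set T) : measurable E -> E `<=` P ->
  (\int[mu]_(x in E) (`|f x| `^ p * W x)%:E)%E \is a fin_num.
Proof.
move=> mE EP; rewrite ge0_fin_numE; last first.
  by apply: integral_ge0 => x /EP Px; rewrite lee_fin power_ge0.
have fB' x : P x -> `|f x| `^ p <= `|B| `^ p.
  move=> Px; apply: ge0_ler_powR; rewrite ?nnegrE ?(ltW p0)//.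
  by apply: le_trans (fB Px) _; exact: ler_norm.
apply: (@le_lt_trans _ _ ((`|B| `^ p)%:E * \int[mu]_(x in P) (W x)%:E)%E).
  apply: le_trans (power_int_le mP (@subset_refl _ P) (powR_ge0 _ _) fB').
  exact: power_int_mono.
by rewrite lte_mul_pinfty ?lee_fin ?powR_ge0.
Qed.

Definition pint (z : T) (r : R) : R :=
  fine (\int[mu]_(x in cball z r) (`|f x| `^ p * W x)%:E).

Lemma pintE z r :
  (\int[mu]_(x in cball z r) (`|f x| `^ p * W x)%:E)%E = (pint z r)%:E.
Proof. by rewrite fineK// power_int_fin//; exact: cball_sub. Qed.

Lemma pint_le z w r s : P z -> P w -> dd z w + r <= s -> pint w r <= pint z s.
Proof.
move=> Pz Pw h; rewrite -lee_fin -!pintE; apply: power_int_mono => //.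
  exact: cball_sub.
exact: cball_subset.
Qed.

Lemma pint_ge0 z r : 0 <= pint z r.
Proof.
by rewrite -lee_fin -pintE integral_ge0// => x [_ Px _]; rewrite lee_fin power_ge0.
Qed.

Lemma vol_le_pint z r c : 0 <= c -> (forall x, cball z r x -> c <= `|f x|) ->
  c `^ p * vol z r <= pint z r.
Proof.
move=> c0 h; rewrite -lee_fin EFinM -volE -pintE.
by apply: power_int_ge => //; exact: cball_sub.
Qed.

Lemma pint_le_vol z r c : 0 <= c ->
  (forall x, cball z r x -> `|f x| `^ p <= c) -> pint z r <= c * vol z r.
Proof.
move=> c0 h; rewrite -lee_fin EFinM -volE -pintE.
by apply: power_int_le => //; exact: cball_sub.
Qed.

Variables (m K : R) (b sK : nat).
Hypotheses (m0 : 0 < m) (fosc : osc_bound m K b f) (K0 : 0 <= K).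
Hypotheses (sKP : 4 * K <= 2 ^+ sK) (bp : A.+1%:R <= b%:R * p).

Let rad (j : nat) : R := 2 ^+ j.+1 / m.

(** At a near maximizer y of the weighted supremum the oscillation bound applies
    with the majorant 2 |f y|, so |f| stays above |f y| / 2 on a ball around y of
    radius a fixed fraction of 1 / m.  With j such that m dd z y is about 2^j,
    that ball lies in the ball of radius rad j around z, whose mass is at most
    2^(A j) times larger up to a constant, while the weight contributes
    2^(- j A.+1). *)
Lemma majorant_le_mean z J : P z -> 4 * m <= 2 ^+ J ->
  exists M, exists2 j, (j <= J)%N &
    [/\ 0 <= M, forall w, P w -> `|f w| <= M * (1 + m * dd z w) ^+ b &
        M `^ p * vol z (rad j) <=
        4 `^ p * 2 ^+ (A.+1 + A * (sK + 2)) * (2 ^+ j)^-1 * pint z (rad j)].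
Proof.
move=> Pz mJ; have [y Py ymax] := near_maximizer b (ltW m0) Pz fB.
have x0 : 0 <= m * dd z y by rewrite mulr_ge0 ?dd0 ?ltW.
have [j [xj jx jmin]] := dyadic_scale x0.
set D : R := 1 + m * dd z y in ymax *; set v : R := `|f y| in ymax *.
have D0 : 0 < D by rewrite /D; lra.
have v0 : 0 <= v by exact: normr_ge0.
have M0 : 0 <= 2 * v / D ^+ b by rewrite !mulr_ge0// invr_ge0 exprn_ge0// ltW.
exists (2 * v / D ^+ b), j.
  by apply: jmin; apply: le_trans mJ; rewrite mulrC ler_wpM2r ?(ds_diam dsW)// ltW.
split=> //.
pose del : R := (2 ^+ sK)^-1 / m.
have del0 : 0 < del by rewrite divr_gt0// invr_gt0 exprn_gt0.
have s1 : 1 <= 2 ^+ sK :> R by rewrite exprn_ege1// ler1n.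
have j1 : 1 <= 2 ^+ j :> R by rewrite exprn_ege1// ler1n.
have mdel : m * del = (2 ^+ sK)^-1 by rewrite /del mulrC divfK// gt_eqF.
(* |f| stays above v / 2 on the ball of radius del around y *)
have yball w : cball y del w -> v / 2 <= `|f w|.
  move=> [_ Pw yw].
  have myw : m * dd y w <= (2 ^+ sK)^-1 by rewrite -mdel ler_wpM2l// ltW.
  have myw0 : 0 <= m * dd y w by rewrite mulr_ge0 ?dd0 ?ltW.
  have : `|f w - f y| <= K * (m * dd y w) * (2 * v).
    apply: fosc => // [x Px|]; last first.
      by apply: le_trans myw _; rewrite invf_le1; lra.
    apply: le_trans (ymax x Px) _.
    rewrite -mulrA ler_wpM2l ?mulr_ge0// mulrC ler_pdivrMr ?exprn_gt0//.
    have a1 : 0 <= m * dd y x by rewrite mulr_ge0 ?dd0 ?ltW.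
    have a2 : 0 <= m * dd z x by rewrite mulr_ge0 ?dd0 ?ltW.
    have a3 : m * dd z x <= m * dd z y + m * dd y x.
      by rewrite -mulrDr; apply: (ler_wpM2l (ltW m0)); exact: ddt.
    rewrite -exprMn; apply: lerXn2r; rewrite ?nnegrE /D; [lra|nra|nra].
  have kv : K * (m * dd y w) * (2 * v) <= v / 2.
    have : K * (m * dd y w) <= 1 / 4.
      apply: (le_trans (ler_wpM2l K0 myw)).
      rewrite ler_pdivrMr ?(lt_le_trans ltr01 s1)//.
      move: sKP s1; move: (2 ^+ sK) => S hS hS1. lra.
    nra.
  have := ler_normB (f w - f y) (f w).
  have -> : f w - f y - f w = - f y by ring.
  by rewrite normrN -/v; lra.
have vb : (v / 2) `^ p * vol y del <= pint z (rad j).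
  apply: le_trans (vol_le_pint _ yball) _; first by rewrite divr_ge0.
  apply: pint_le => //.
  have : m * (dd z y + del) <= 2 ^+ j.+1.
    rewrite mulrDr mdel exprS mulr_natl mulr2n lerD//.
    by apply: le_trans j1; rewrite invf_le1; lra.
  by rewrite /rad ler_pdivlMr// mulrC.
have vr : vol z (rad j) <= 2 ^+ (A * (j + 2 + sK)) * vol y del.
  apply: le_trans (vol_doubling _ Py del0); apply: vol_le => //.
  have -> : 2 ^+ (j + 2 + sK) * del = 2 ^+ j / m + 3 * 2 ^+ j / m.
    by rewrite /del !exprD; field; rewrite !gt_eqF.
  rewrite /rad exprS ddC//.
  have : dd z y <= 2 ^+ j / m by rewrite ler_pdivlMr// mulrC.
  have : 0 <= 2 ^+ j / m by rewrite divr_ge0 ?ltW// exprn_gt0.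
  by lra.
(* here the exponent b beats the doubling exponent A by one *)
have Mp : (2 * v / D ^+ b) `^ p <=
    4 `^ p * (v / 2) `^ p * (2 ^+ A.+1 * (2 ^+ j) ^- A.+1).
  have -> : 2 * v / D ^+ b = 4 * (v / 2) * (D^-1 ^+ b).
    by rewrite exprVn; field; rewrite expf_neq0//; lra.
  have v20 : 0 <= v / 2 by rewrite divr_ge0.
  have Dv0 : 0 < D^-1 by rewrite invr_gt0.
  rewrite powRM ?mulr_ge0 ?exprn_ge0 ?(ltW Dv0)// powRM//.
  rewrite ler_wpM2l ?mulr_ge0 ?powR_ge0//.
  rewrite -powR_mulrn ?(ltW Dv0)// -powRrM.
  apply: (@le_trans _ _ (D^-1 `^ A.+1%:R)).
    by apply: ger_powR => //; rewrite Dv0 invf_le1//=; rewrite /D; lra.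
  rewrite powR_mulrn ?(ltW Dv0)// -exprVn -exprMn; apply: lerXn2r.
  - by rewrite nnegrE ltW.
  - by rewrite nnegrE divr_ge0// exprn_ge0.
  - by rewrite ler_pdivlMr ?exprn_gt0// mulrC ler_pdivrMr.
apply: (@le_trans _ _ ((4 `^ p * (v / 2) `^ p * (2 ^+ A.+1 * (2 ^+ j) ^- A.+1)) *
    (2 ^+ (A * (j + 2 + sK)) * vol y del))).
  by apply: ler_pM => //; rewrite ?powR_ge0 ?vol_ge0.
have -> : 4 `^ p * (v / 2) `^ p * (2 ^+ A.+1 * (2 ^+ j) ^- A.+1) *
    (2 ^+ (A * (j + 2 + sK)) * vol y del) =
  4 `^ p * 2 ^+ (A.+1 + A * (sK + 2)) * (2 ^+ j)^-1 * ((v / 2) `^ p * vol y del).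
  have -> : (A * (j + 2 + sK) = j * A + A * (sK + 2))%N.
    by rewrite -addnA mulnDr (mulnC A j) (addnC 2).
  rewrite exprD (exprM 2 j A) (exprD _ A.+1) (exprS (2 ^+ j) A).
  have X0 : (2 ^+ j) ^+ A != 0 :> R by rewrite !expf_neq0.
  have Y0 : 2 ^+ j != 0 :> R by rewrite expf_neq0.
  move: (4 `^ p) ((v / 2) `^ p) (vol y del) (2 ^+ A.+1) (2 ^+ (A * (sK + 2)))
    X0 Y0 => a c e g h.
  by move: (2 ^+ j) => Y; move: (Y ^+ A) => X X0 Y0; field; rewrite X0 Y0.
by rewrite ler_wpM2l// !mulr_ge0 ?powR_ge0 ?exprn_ge0 ?invr_ge0 ?exprn_ge0.
Qed.

Lemma sum_pint_le (q : nat) (e r : R) (s : seq T) :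
  uniq s -> separated_seq e s -> {in s, forall z, P z} -> 0 < e -> 0 < r ->
  e <= 2 ^+ q * r ->
  \sum_(z <- s) vol z e / vol z r * pint z r <=
  2 ^+ (A * (q + 4)) * fine (\int[mu]_(x in P) (`|f x| `^ p * W x)%:E)%E.
Proof.
move=> us sep sP e0 r0 eq.
have C x : P x -> \sum_(z <- s) vol z e / vol z r * \1_(cball z r) x <=
    2 ^+ (A * (q + 4)).
  by move=> Px; apply: overlap.
have a0 z : 0 <= vol z e / vol z r by rewrite divr_ge0 ?vol_ge0.
have := @sum_integral_le _ _ _ mu P (fun x => `|f x| `^ p * W x) s _
  (fun z => cball z r) _ mP measurable_power power_ge0 a0 (fun z => mB _ _)
  (exprn_ge0 _ (ler0n _ 2)) C.
rewrite -lee_fin EFinM fineK ?power_int_fin// -sumEFin; apply: le_trans.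
rewrite le_eqVlt; apply/orP; left; apply/eqP; apply: eq_bigr => z _.
rewrite EFinM -pintE (_ : P `&` cball z r = cball z r)//.
by apply/setIidPr; exact: cball_sub.
Qed.

Lemma sum_half_le2 n : \sum_(j < n) (2 ^+ j)^-1 <= 2 :> R.
Proof.
suff -> : \sum_(j < n) (2 ^+ j)^-1 = 2 - 2 * (2 ^+ n)^-1 :> R.
  by rewrite lerBlDr lerDl mulr_ge0// invr_ge0 exprn_ge0.
elim: n => [|n IH]; first by rewrite big_ord0 expr0; field.
by rewrite big_ord_recr /= IH exprS invfM; field; rewrite expf_neq0.
Qed.

(** Sum [majorant_le_mean] over s; for each j the means over the balls of radius
    rad j are controlled by [overlap], and the factors 2^(-j) have sum at most 2. *)
Lemma sum_majorant_le (q : nat) (e : R) (s : seq T) :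
  uniq s -> separated_seq e s -> {in s, forall z, P z} -> 0 < e -> e <= 2 ^+ q / m ->
  exists2 M : T -> R,
    {in s, forall z, 0 <= M z /\
       forall w, P w -> `|f w| <= M z * (1 + m * dd z w) ^+ b} &
    \sum_(z <- s) M z `^ p * vol z e <=
    4 `^ p * 2 ^+ (A.+1 + A * (sK + 2) + A * (q + 4) + 1) *
      fine (\int[mu]_(x in P) (`|f x| `^ p * W x)%:E)%E.
Proof.
move=> us sep sP e0 eq.
have [J [mJ _ _]] := dyadic_scale (mulr_ge0 (ler0n R 4) (ltW m0)).
have /choice[Mj hMj] z : exists Mj : R * nat, P z ->
    [/\ (Mj.2 <= J)%N, 0 <= Mj.1,
     forall w, P w -> `|f w| <= Mj.1 * (1 + m * dd z w) ^+ b &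
        Mj.1 `^ p * vol z (rad Mj.2) <=
        4 `^ p * 2 ^+ (A.+1 + A * (sK + 2)) * (2 ^+ Mj.2)^-1 * pint z (rad Mj.2)].
  have [Pz|nPz] := pselect (P z); last by exists (0, 0%N).
  by have [M [j jJ [? ? ?]]] := majorant_le_mean Pz mJ; exists (M, j).
have rad0 j : 0 < rad j by rewrite divr_gt0// exprn_gt0.
have erad j : e <= 2 ^+ q * rad j.
  apply: le_trans eq _; rewrite /rad mulrA ler_pM2r ?invr_gt0//.
  by rewrite ler_peMr ?exprn_ge0// exprn_ege1// ler1n.
exists (fun z => (Mj z).1) => [z /sP/hMj[]//|].
set I := fine _; set c := 4 `^ p * 2 ^+ (A.+1 + A * (sK + 2)).
have c0 : 0 <= c by rewrite mulr_ge0 ?powR_ge0 ?exprn_ge0.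
have I0 : 0 <= I.
  by apply: fine_ge0; apply: integral_ge0 => x Px; rewrite lee_fin power_ge0.
have F0 z j : 0 <= c * (2 ^+ j)^-1 * (vol z e / vol z (rad j) * pint z (rad j)).
  by rewrite !mulr_ge0 ?invr_ge0 ?exprn_ge0 ?vol_ge0 ?pint_ge0.
apply: (@le_trans _ _ (\sum_(z <- s) \sum_(j < J.+1)
    c * (2 ^+ j)^-1 * (vol z e / vol z (rad j) * pint z (rad j)))).
  rewrite big_seq [leRHS]big_seq; apply: ler_sum => z zs.
  have Pz := sP z zs; have [jJ M0 _ hM] := hMj z Pz.
  rewrite (bigD1 (Ordinal (leq_ltn_trans jJ (ltnSn J)))) //=.
  apply: (@le_trans _ _ (c * (2 ^+ (Mj z).2)^-1 * (vol z e / vol z (rad (Mj z).2) *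
    pint z (rad (Mj z).2)))); last by rewrite lerDl sumr_ge0.
  have [V0|V0] := eqVneq (vol z (rad (Mj z).2)) 0.
    suff -> : vol z e = 0 by rewrite mulr0 !mul0r mulr0.
    apply/eqP; rewrite eq_le vol_ge0 andbT.
    have -> : 0 = 2 ^+ (A * q) * vol z (rad (Mj z).2) by rewrite V0 mulr0.
    by apply: le_trans (vol_doubling _ Pz (rad0 _)); apply: vol_le1.
  have -> : (Mj z).1 `^ p * vol z e = (Mj z).1 `^ p * vol z (rad (Mj z).2) *
      (vol z e / vol z (rad (Mj z).2)) by field.
  rewrite [leRHS](_ : _ = c * (2 ^+ (Mj z).2)^-1 * pint z (rad (Mj z).2) *
      (vol z e / vol z (rad (Mj z).2))); last by ring.
  by rewrite ler_wpM2r// divr_ge0 ?vol_ge0.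
rewrite exchange_big /=.
apply: (@le_trans _ _ (\sum_(j < J.+1) (2 ^+ j)^-1 * (c * (2 ^+ (A * (q + 4)) * I)))).
  apply: ler_sum => j _; rewrite -mulr_sumr mulrAC -mulrA mulrC -mulrA mulrC.
  rewrite -mulrA ler_wpM2l ?invr_ge0 ?exprn_ge0// ler_wpM2l//.
  by apply: sum_pint_le.
rewrite -mulr_suml.
apply: le_trans (ler_wpM2r _ (sum_half_le2 _)) _.
  by rewrite !mulr_ge0 ?exprn_ge0.
rewrite le_eqVlt; apply/orP; left; apply/eqP.
rewrite /c [in RHS]exprD [in RHS](exprD _ (A.+1 + A * (sK + 2))) expr1.
by ring.
Qed.

End PowerIntegrals.

End DoublingSpaces.

(** * Marcinkiewicz-Zygmund inequalities in a doubling space *)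

Section MarcinkiewiczZygmund.
Context {dsp : measure_display} {T : measurableType dsp} {R : realType}.
Variable mu : {measure set T -> \bar R}.
Variables (P : set T) (dd : T -> T -> R) (W : T -> R) (A : nat).
Hypothesis dsW : doubling_space mu P dd W A.

Let mP := ds_measurable dsW.
Let mB := ds_cball dsW.

Notation mass E := (\int[mu]_(x in E) (W x)%:E)%E.
Notation ball := (cball P dd).

Lemma mass_lty : (mass P < +oo)%E \/ mass P = +oo%E.
Proof.
case: (ltP (mass P) +oo%E) => [|h]; first by left.
by right; apply/eqP; rewrite -leye_eq.
Qed.

(** Doubling up to the diameter bounds the total mass by a multiple of the mass of
    any ball. *)
Lemma mass_ball_infty z r : mass P = +oo%E -> P z -> 0 < r ->
  mass (ball z r) = +oo%E.
Proof.
move=> PW Pz r0.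
have [j [hj _ _]] := dyadic_scale (divr_ge0 (ler0n R 4) (ltW r0)).
have := mass_doubling dsW j Pz r0.
rewrite (cball_full dsW Pz) -?ler_pdivrMr// PW leye_eq => /eqP.
have m0 := mass_ge0 dsW (@cball_sub _ _ _ P dd z r).
case: (integral _ _ _) m0 => [v|//|//] _.
by rewrite -EFinM.
Qed.

Definition ball_sup (f : T -> R) (p : R) (z : T) (r : R) : \bar R :=
  ereal_sup [set (`|f w| `^ p)%:E | w in ball z r].

Definition ball_inf (f : T -> R) (p : R) (z : T) (r : R) : \bar R :=
  ereal_inf [set (`|f w| `^ p)%:E | w in ball z r].

Lemma ball_self z r : P z -> 0 <= r -> ball z r z.
Proof. by move=> Pz r0; split; rewrite // (ds_refl dsW). Qed.

Lemma ball_inf_ge0 f p z r : (0 <= ball_inf f p z r)%E.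
Proof. by apply: le_ereal_inf_tmp => _ [w _ <-]; rewrite lee_fin powR_ge0. Qed.

Lemma ball_sup_ge0 f p z r : P z -> 0 <= r -> (0 <= ball_sup f p z r)%E.
Proof.
move=> Pz r0; apply: (@le_trans _ _ (`|f z| `^ p)%:E).
  by rewrite lee_fin powR_ge0.
by apply: ereal_sup_ubound; exists z => //; exact: ball_self.
Qed.

Section OneFunction.
Variables (f : T -> R) (B p m K : R) (b sK q : nat) (e : R) (Xi : set T).
Hypotheses (mf : measurable_fun P f) (fB : forall w, P w -> `|f w| <= B).
Hypotheses (p0 : 0 < p) (m0 : 0 < m) (fosc : osc_bound P dd m K b f).
Hypotheses (K0 : 0 <= K) (sKP : 4 * K <= 2 ^+ sK) (bp : A.+1%:R <= b%:R * p).
Hypotheses (e0 : 0 < e) (eq : e <= 2 ^+ q / m).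
Hypotheses (XiP : Xi `<=` P).
Hypothesis Xisep : forall z w, Xi z -> Xi w -> z <> w -> e <= dd z w.

Let N : nat := (A.+1 + A * (sK + 2) + A * (q + 4) + 1)%N.
Let F := (\int[mu]_(x in P) (`|f x| `^ p * W x)%:E)%E.

Lemma power_int_ge0 : (0 <= F)%E.
Proof. by apply: integral_ge0 => x Px; rewrite lee_fin (power_ge0 dsW). Qed.

(** Near a point where f does not vanish |f| is bounded below on a ball, which has
    infinite mass. *)
Lemma power_int_infty y : mass P = +oo%E -> P y -> f y != 0 -> F = +oo%E.
Proof.
move=> PW Py fy.
have v0 : 0 < `|f y| by rewrite normr_gt0.
have B0 : 0 < B by exact: lt_le_trans (fB Py).
have K1 : 0 < K + 1 by rewrite ltr_wpDl.
pose del := `|f y| / (2 * m * (K + 1) * B).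
have C0 : 0 < 2 * m * (K + 1) * B by rewrite !mulr_gt0.
have d0 : 0 < del by rewrite divr_gt0.
have mdel : m * del * ((K + 1) * B) = `|f y| / 2.
  by rewrite /del; field; rewrite !gt_eqF.
have mdel1 : m * del <= 1.
  rewrite -(@ler_pM2r _ ((K + 1) * B)) ?mulr_gt0// mdel mul1r.
  by have := fB Py; have := mulr_ge0 K0 (ltW B0); rewrite mulrDl; lra.
have hb w : ball y del w -> `|f y| / 2 <= `|f w|.
  move=> [_ Pw yw].
  have myw : m * dd y w <= m * del by rewrite ler_wpM2l// ltW.
  have myw0 : 0 <= m * dd y w by rewrite mulr_ge0 ?(ds_ge0 dsW) ?ltW.
  have : `|f w - f y| <= K * (m * dd y w) * B.
    apply: fosc => // [x Px|]; last exact: le_trans mdel1.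
    apply: le_trans (fB Px) _; rewrite ler_peMr ?(ltW B0)// exprn_ege1// lerDl.
    by rewrite mulr_ge0 ?(ds_ge0 dsW) ?ltW.
  have : K * (m * dd y w) * B <= `|f y| / 2.
    rewrite -mdel; have := ler_wpM2r (ltW (mulr_gt0 K1 B0)) myw.
    by have := mulr_ge0 myw0 (ltW B0); nra.
  have := ler_normB (f w - f y) (f w).
  have -> : f w - f y - f w = - f y by ring.
  by rewrite normrN; lra.
have := power_int_ge dsW mf p0 (mB y del) (@cball_sub _ _ _ _ _ _ _)
  (divr_ge0 (normr_ge0 (f y)) (ler0n R 2)) hb.
rewrite mass_ball_infty// gt0_muley; last first.
  by rewrite lte_fin powR_gt0// divr_gt0.
rewrite leye_eq => /eqP FE; apply/eqP; rewrite -leye_eq -FE.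
apply: (power_int_mono dsW p mf) => //; exact: cball_sub.
Qed.

(** If the total mass is infinite, the right-hand side is infinite unless f
    vanishes on P, and then the left-hand side is 0. *)
Lemma mz_upper :
  (\esum_(z in Xi) (ball_sup f p z e * mass (ball z e)) <=
   ((4 * (1 + 2 ^+ q) ^+ b) `^ p * 2 ^+ N)%:E * F)%E.
Proof.
have D0 : 0 <= (1 + 2 ^+ q) ^+ b :> R by rewrite exprn_ge0// addr_ge0// exprn_ge0.
have cst0 : 0 < (4 * (1 + 2 ^+ q) ^+ b) `^ p * 2 ^+ N.
  have q0 : 0 < 1 + 2 ^+ q :> R by rewrite addr_gt0// exprn_gt0.
  by rewrite mulr_gt0 ?powR_gt0 ?exprn_gt0// mulr_gt0// exprn_gt0.
have [finW|PW] := mass_lty; last first.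
  have [[y Py fy]|f0] := pselect (exists2 y, P y & f y != 0).
    by rewrite (power_int_infty PW Py fy) gt0_muley ?lte_fin// leey.
  rewrite esum1 ?mule_ge0 ?lee_fin ?power_int_ge0 ?(ltW cst0)// => z /XiP Pz.
  suff -> : ball_sup f p z e = 0%E by rewrite mul0e.
  apply/eqP; rewrite eq_le ball_sup_ge0 ?(ltW e0)// andbT.
  apply: ge_ereal_sup => _ [w [_ Pw _] <-].
  have -> : f w = 0 by apply/eqP/negPn/negP => fw; apply: f0; exists w.
  by rewrite normr0 powR0// gt_eqF.
apply: ge_ereal_sup => _ [S [finS SXi] <-].
rewrite fsbig_finite//=; set s := fset_set S.
have sS (z : T) : z \in s -> Xi z by rewrite in_fset_set// inE => /SXi.
have sP : {in s, forall z, P z} by move=> z /sS/XiP.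
have sep : separated_seq dd e s by move=> z w /sS hz /sS hw; exact: Xisep.
have [M hM sM] := sum_majorant_le dsW finW mf fB p0 m0 fosc K0 sKP bp
  (fset_uniq s) sep sP e0 eq.
have Ffin : F = (fine F)%:E.
  by rewrite fineK//; exact: (power_int_fin dsW finW mf fB p0).
apply: (@le_trans _ _ (\sum_(z <- s)
    (((1 + 2 ^+ q) ^+ b) `^ p * (M z `^ p * vol mu P dd W z e))%:E)%E); last first.
  rewrite sumEFin -mulr_sumr Ffin -EFinM lee_fin.
  apply: le_trans (ler_wpM2l (powR_ge0 _ _) sM) _.
  rewrite powRM// -/N -/F.
  by rewrite le_eqVlt; apply/orP; left; apply/eqP; ring.
rewrite big_seq [leRHS]big_seq; apply: lee_sum => z zs.
have Pz := sP z zs; have [M0 hMz] := hM z zs.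
rewrite (volE dsW finW) mulrA EFinM lee_wpmul2r ?lee_fin ?(vol_ge0 dsW finW)//.
apply: ge_ereal_sup => _ [w [_ Pw zw] <-]; rewrite lee_fin -powRM//.
apply: ge0_ler_powR; rewrite ?nnegrE ?mulr_ge0 ?(ltW p0)//.
apply: le_trans (hMz w Pw) _; rewrite mulrC ler_wpM2r//.
have dzw := ds_ge0 dsW Pz Pw.
apply: lerXn2r; rewrite ?nnegrE ?addr_ge0 ?mulr_ge0 ?exprn_ge0 ?(ltW m0)//.
rewrite lerD2l; apply: (@le_trans _ _ (m * e)); first by rewrite ler_wpM2l ?(ltW m0).
by rewrite mulrC -ler_pdivlMr.
Qed.

End OneFunction.

Lemma powRD_le (x y p : R) : 0 <= x -> 0 <= y -> 0 < p ->
  (x + y) `^ p <= 2 `^ p * (x `^ p + y `^ p).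
Proof.
move=> x0 y0 p0; wlog xy : x y x0 y0 / x <= y => [h|].
  by have [/h|/ltW/h] := leP x y; [exact|rewrite addrC [X in _ * X]addrC; exact].
apply: (@le_trans _ _ ((2 * y) `^ p)).
  by apply: ge0_ler_powR; rewrite ?nnegrE ?addr_ge0 ?mulr_ge0 ?(ltW p0)//; lra.
by rewrite powRM// ler_wpM2l ?powR_ge0// lerDr powR_ge0.
Qed.

(** The disjoint balls of radius e / 4 all have mass at least a fixed fraction of
    the total mass. *)
Lemma finite_separated (e : R) (Xi : set T) :
  (mass P < +oo)%E -> mass P != 0%E -> 0 < e -> Xi `<=` P ->
  (forall z w, Xi z -> Xi w -> z <> w -> e <= dd z w) -> finite_set Xi.
Proof.
move=> finW PW0 e0 XiP Xisep; apply: contrapT => infXi.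
have [z0 Xz0] : exists z, Xi z.
  have [S SX] := infinite_set_fset 1 infXi.
  by rewrite cardfs_gt0 => /fset0Pn[z zS]; exists z; exact: SX.
have Pz0 := XiP _ Xz0.
have e4 : 0 < e / 4 by rewrite divr_gt0.
have [j [hj _ _]] := dyadic_scale (divr_ge0 (ler0n R 4) (ltW e4)).
set v := vol mu P dd W z0 (4 + e / 4).
have vP z r : P z -> 4 <= r -> vol mu P dd W z r = v.
  move=> Pz r4; rewrite /v /vol (cball_full dsW Pz r4).
  by rewrite (cball_full dsW Pz0)//; lra.
have v0 : 0 < v.
  rewrite lt0r (vol_ge0 dsW finW) andbT -eqe -(volE dsW finW).
  by rewrite (cball_full dsW Pz0)//; lra.
have [S SX Sn] := infinite_set_fset (2 ^ (A * j)).+1 infXi.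
have hS : \sum_(z <- S) vol mu P dd W z (e / 4) <= v.
  apply: (packing dsW finW (e := e)) => //; first exact: fset_uniq.
  - by move=> z w zS wS; apply: Xisep; exact: SX.
  - by move=> z /SX/XiP.
  - by move=> z /SX/XiP Pz; rewrite lerD2r (ds_diam dsW).
suff : v < \sum_(z <- S) vol mu P dd W z (e / 4) by rewrite ltNge hS.
apply: (@lt_le_trans _ _ (\sum_(z <- S) v / 2 ^+ (A * j))).
  rewrite big_const_seq iter_addr_0 count_predT -[X in X < _]mulr1 -mulrnAr.
  rewrite ltr_pM2l// -mulr_natr ltr_pdivlMl ?exprn_gt0// mulr1 -natrX ltr_nat.
  exact: Sn.
rewrite big_seq [leRHS]big_seq; apply: ler_sum => z /SX/XiP Pz.
rewrite ler_pdivrMr ?exprn_gt0// mulrC.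
have h4 : 4 <= 2 ^+ j * (e / 4) by rewrite -ler_pdivrMr.
rewrite -(vP z (2 ^+ j * (e / 4)))//.
exact: vol_doubling.
Qed.

Section LowerBound.
Variables (f : T -> R) (B p m K delta : R) (b sK : nat) (e : R) (Xi : set T).
Hypotheses (mf : measurable_fun P f) (fB : forall w, P w -> `|f w| <= B).
Hypotheses (p0 : 0 < p) (m0 : 0 < m) (fosc : osc_bound P dd m K b f).
Hypotheses (K0 : 0 <= K) (sKP : 4 * K <= 2 ^+ sK) (bp : A.+1%:R <= b%:R * p).
Hypotheses (e0 : 0 < e) (me : m * e <= delta) (delta1 : delta <= 1).
Hypotheses (XiP : Xi `<=` P).
Hypothesis Xisep : forall z w, Xi z -> Xi w -> z <> w -> e <= dd z w.
Hypothesis Xicov : forall w, P w -> exists2 z, Xi z & ball z e w.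

Let N : nat := (A.+1 + A * (sK + 2) + A * (0 + 4) + 1)%N.
Let F := (\int[mu]_(x in P) (`|f x| `^ p * W x)%:E)%E.

Hypotheses (small1 : 16 * K * delta <= 1).
Hypotheses (small2 : (16 * K * delta) `^ p * 2 ^+ N <= 2^-1).

Let d0 : 0 <= delta.
Proof. by apply: le_trans me; rewrite mulr_ge0 ?ltW. Qed.

Let sum_ge0 z : Xi z -> (0 <= ball_inf f p z e * mass (ball z e))%E.
Proof.
by move=> _; rewrite mule_ge0 ?ball_inf_ge0// (mass_ge0 dsW)//; exact: cball_sub.
Qed.

Lemma osc_on_ball z M w : P z ->
  (forall w, P w -> `|f w| <= M * (1 + m * dd z w) ^+ b) -> 0 <= M ->
  ball z e w -> `|f w - f z| <= K * delta * M.
Proof.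
move=> Pz hM M0 [_ Pw zw].
have h : m * dd z w <= delta by apply: le_trans me; rewrite ler_wpM2l// ltW.
apply: le_trans (fosc Pz hM Pw (le_trans h delta1)) _.
by rewrite ler_wpM2r// ler_wpM2l.
Qed.

(** On each ball the p-th powers of |f| exceed their infimum by an oscillation
    term, up to a factor 2^p; summed over the balls this term is at most half of
    the left-hand side, by [sum_majorant_le] and the smallness of delta.  If the
    mass is infinite, smallness of delta gives a ball on which |f| is bounded below,
    so that the right-hand side is infinite. *)
Lemma mz_lower :
  (F <= (2 * 2 `^ p)%:E *
     \esum_(z in Xi) (ball_inf f p z e * mass (ball z e)))%E.
Proof.
have cst0 : 0 < 2 * 2 `^ p :> R by rewrite mulr_gt0// powR_gt0.
have S0 : (0 <= \esum_(z in Xi) (ball_inf f p z e * mass (ball z e)))%E.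
  by apply: esum_ge0 => z; exact: sum_ge0.
have [finW|PW] := mass_lty; last first.
  have [[x Px fx]|f0] := pselect (exists2 y, P y & f y != 0); last first.
    rewrite /F (eq_integral (fun=> 0%E)) ?integral0 ?mule_ge0 ?lee_fin ?(ltW cst0)//.
    move=> w; rewrite inE => Pw.
    have -> : f w = 0 by apply/eqP/negPn/negP => fw; apply: f0; exists w.
    by rewrite normr0 powR0 ?mul0r// gt_eqF.
  have [y Py] := near_maximizer dsW 0 (ltW m0) Px fB.
  rewrite expr0 => hy.
  have v0 : 0 < `|f y|.
    have := hy _ Px; have : 0 < `|f x| by rewrite normr_gt0.
    by rewrite invr1 expr0 !mulr1; lra.
  have [z Xz [_ _ zy]] := Xicov Py; have Pz := XiP Xz.
  have hz w : P w -> `|f w| <= 2 * `|f y| * (1 + m * dd z w) ^+ b.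
    move=> Pw; apply: le_trans (hy w Pw) _; rewrite invr1 expr0 !mulr1.
    rewrite ler_peMr ?mulr_ge0// exprn_ege1// lerDl.
    by rewrite mulr_ge0 ?(ds_ge0 dsW) ?ltW.
  have osc := osc_on_ball Pz hz (mulr_ge0 (ler0n R 2) (ltW v0)).
  have hb w : ball z e w -> `|f y| / 2 <= `|f w|.
    move=> zw; have h1 := osc w zw; have h2 := osc y (And3 Pz Py zy).
    have h3 : K * delta * (2 * `|f y|) <= `|f y| / 8.
      by have := ler_wpM2r (ltW v0) small1; lra.
    have := ler_normB (f w - f z) (f w).
    have := ler_normB (f y - f z) (f y).
    have := ler_normD (f z) (f y - f z).
    have -> : f z + (f y - f z) = f y by ring.
    have -> : f w - f z - f w = - f z by ring.
    by rewrite normrN; lra.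
  rewrite (_ : esum _ _ = +oo%E); first by rewrite gt0_muley ?lte_fin// leey.
  apply/eqP; rewrite -leye_eq; apply: esum_ge.
  exists [set z]; first by split=> // _ ->.
  rewrite fsbig_set1 mass_ball_infty// gt0_muley//.
  apply: (@lt_le_trans _ _ ((`|f y| / 2) `^ p)%:E).
    by rewrite lte_fin powR_gt0// divr_gt0.
  apply: le_ereal_inf_tmp => _ [w zw <-]; rewrite lee_fin.
  by apply: ge0_ler_powR; rewrite ?nnegrE ?divr_ge0 ?(ltW p0) ?hb.
have [PW0|PW0] := eqVneq (mass P) 0%E.
  apply: (@le_trans _ _ 0%E); last by rewrite mule_ge0 ?lee_fin ?(ltW cst0).
  have fB' x : P x -> `|f x| `^ p <= `|B| `^ p.
    move=> Px; apply: ge0_ler_powR; rewrite ?nnegrE ?(ltW p0)//.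
    by apply: le_trans (fB Px) _; exact: ler_norm.
  have := power_int_le dsW mf mP (@subset_refl _ P) (powR_ge0 _ _) fB'.
  by rewrite PW0 mule0.
have finXi := finite_separated finW PW0 e0 XiP Xisep.
rewrite esum_fset//; last by move=> z; rewrite inE; exact: sum_ge0.
rewrite fsbig_finite//=; set s := fset_set Xi.
have sX (z : T) : (z \in s) = (z \in Xi) by rewrite in_fset_set.
have sXi (z : T) : z \in s -> Xi z by rewrite sX inE.
have sP : {in s, forall z, P z} by move=> z /sXi/XiP.
have sep : separated_seq dd e s by move=> z w /sXi hz /sXi hw; exact: Xisep.
have eq : e <= 2 ^+ 0 / m.
  by rewrite expr0 ler_pdivlMr// mulrC; exact: le_trans me delta1.
have [M hM sM] := sum_majorant_le dsW finW mf fB p0 m0 fosc K0 sKP bp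
  (fset_uniq s) sep sP e0 eq.
have Ffin : F = (fine F)%:E.
  by rewrite fineK//; exact: (power_int_fin dsW finW mf fB p0).
pose t z := fine (ball_inf f p z e).
have tE z : P z -> ball_inf f p z e = (t z)%:E.
  move=> Pz; rewrite fineK// ge0_fin_numE ?ball_inf_ge0//.
  apply: (@le_lt_trans _ _ (`|f z| `^ p)%:E); last by rewrite ltry.
  by apply: ereal_inf_lbound; exists z => //; apply: ball_self => //; exact: ltW.
have t0 z : 0 <= t z by apply: fine_ge0; exact: ball_inf_ge0.
pose I := \sum_(z <- s) t z * vol mu P dd W z e.
have -> : (\sum_(z <- s) ball_inf f p z e * mass (ball z e))%E = I%:E.
  rewrite -sumEFin big_seq [RHS]big_seq; apply: eq_bigr => z zs.
  by rewrite (tE _ (sP z zs)) (volE dsW finW) EFinM.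
set V := vol mu P dd W in sM I *.
have V0 z r : 0 <= V z r by exact: (vol_ge0 dsW finW).
have step1 : fine F <= \sum_(z <- s) pint mu P dd W f p z e.
  rewrite -lee_fin -Ffin -sumEFin.
  have cov x : P x -> exists2 z, z \in s & ball z e x.
    by move=> Px; have [z Xz zx] := Xicov Px; exists z; rewrite // sX inE.
  apply: le_trans (integral_le_sum mu mP (measurable_power dsW p mf)
    (power_ge0 dsW f p) (fun z => mB z e) cov) _.
  rewrite le_eqVlt; apply/orP; left; apply/eqP; apply: eq_bigr => z _.
  rewrite -(pintE dsW finW mf fB p0) (_ : P `&` ball z e = ball z e)//.
  by apply/setIidPr; exact: cball_sub.
have step2 (z : T) : z \in s -> pint mu P dd W f p z e <=
    2 `^ p * (t z * V z e) + (4 * K * delta) `^ p * (M z `^ p * V z e).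
  move=> zs; have Pz := sP z zs; have [M0 hMz] := hM z zs.
  have osc := osc_on_ball Pz hMz M0.
  have KM0 : 0 <= 2 * K * delta * M z by rewrite !mulr_ge0.
  apply: (@le_trans _ _
      (2 `^ p * (t z + (2 * K * delta * M z) `^ p) * V z e)); last first.
    rewrite (_ : 4 * K * delta = 2 * (2 * K * delta)); last by ring.
    rewrite (@powRM _ 2) ?mulr_ge0// (@powRM _ (2 * K * delta) (M z)) ?mulr_ge0//.
    by rewrite le_eqVlt; apply/orP; left; apply/eqP; ring.
  apply: (pint_le_vol dsW finW mf fB p0).
    by rewrite mulr_ge0 ?powR_ge0 ?addr_ge0 ?powR_ge0.
  move=> w zw.
  have h w' : ball z e w' -> `|f w| `^ p <=
      2 `^ p * (`|f w'| `^ p + (2 * K * delta * M z) `^ p).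
    move=> zw'; apply: le_trans (powRD_le _ _ _) => //.
    apply: ge0_ler_powR; rewrite ?nnegrE ?addr_ge0 ?(ltW p0)//.
    have h1 := osc w zw; have h2 := osc w' zw'.
    have := ler_normB (f w - f z) (f w' - f z).
    have := ler_normD (f w') (f w - f z - (f w' - f z)).
    have -> : f w' + (f w - f z - (f w' - f z)) = f w by ring.
    by lra.
  have p2 : 0 < 2 `^ p :> R by rewrite powR_gt0.
  rewrite -ler_pdivrMl// -lerBlDr -lee_fin -tE//.
  apply: le_ereal_inf_tmp => _ [w' zw' <-]; rewrite lee_fin lerBlDr ler_pdivrMl//.
  exact: h.
have F0 : 0 <= fine F by apply: fine_ge0; exact: power_int_ge0.
have step3 : fine F <= 2 `^ p * I + fine F / 2.
  apply: (le_trans step1); apply: (@le_trans _ _ (2 `^ p * I +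
      (4 * K * delta) `^ p * \sum_(z <- s) M z `^ p * V z e)).
    rewrite /I !mulr_sumr -big_split /= big_seq [leRHS]big_seq.
    by apply: ler_sum => z; exact: step2.
  rewrite lerD2l; apply: (le_trans (ler_wpM2l (powR_ge0 _ _) sM)).
  rewrite -/N -/F mulrA [_ `^ p * (4 `^ p * _)]mulrA -powRM ?mulr_ge0//.
  rewrite (_ : 4 * K * delta * 4 = 16 * K * delta); last by ring.
  by rewrite mulrC ler_wpM2l.
by rewrite Ffin -EFinM lee_fin; lra.
Qed.

End LowerBound.

End MarcinkiewiczZygmund.

(** * The geodesic distance of the sphere *)

Section SphericalDistance.
Variable R : realType.
Implicit Types (a b c : nat -> R) (k : nat).

(** Vectors are functions on nat of which the first k values count; the same
    function can then be read coordinatewise without casting indices. *)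
Definition dot k a b : R := \sum_(i < k) a i * b i.

Lemma dotC k a b : dot k a b = dot k b a.
Proof. by apply: eq_bigr => i _; rewrite mulrC. Qed.

Definition comb (s : R) a (t : R) b : nat -> R := fun i => s * a i + t * b i.

Lemma dot_combl k s a t b c :
  dot k (comb s a t b) c = s * dot k a c + t * dot k b c.
Proof.
by rewrite /dot !mulr_sumr -big_split /=; apply: eq_bigr => i _; rewrite /comb; ring.
Qed.

Lemma dot_combr k s a t b c :
  dot k c (comb s a t b) = s * dot k c a + t * dot k c b.
Proof. by rewrite dotC dot_combl !(dotC _ c). Qed.

Lemma dot_ge0 k a : 0 <= dot k a a.
Proof. by apply: sumr_ge0 => i _; rewrite -expr2 sqr_ge0. Qed.

Lemma dot_eq0 k a : dot k a a = 0 -> forall i, (i < k)%N -> a i = 0.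
Proof.
move=> h i ik; have := psumr_eq0P (P := xpredT) (F := fun i : 'I_k => a i * a i) _ h.
move=> /(_ _ (Ordinal ik) isT) /= e; apply/eqP; rewrite -sqrf_eq0 expr2 e//.
by move=> j _; rewrite -expr2 sqr_ge0.
Qed.

Lemma cauchy_schwarz k a b : dot k a b ^+ 2 <= dot k a a * dot k b b.
Proof.
have [b0|b0] := eqVneq (dot k b b) 0.
  rewrite b0 mulr0 (_ : dot k a b = 0) ?expr0n// /dot big1// => i _.
  by rewrite (dot_eq0 b0) ?mulr0.
have bp : 0 < dot k b b by rewrite lt0r b0 dot_ge0.
have := dot_ge0 k (comb (dot k b b) a (- dot k a b) b).
rewrite dot_combl !dot_combr (dotC k b a).
rewrite (_ : _ + _ = dot k b b * (dot k a a * dot k b b - dot k a b ^+ 2)).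
  by rewrite pmulr_rge0// subr_ge0.
by ring.
Qed.

Definition unit_vec k a : Prop := dot k a a = 1.

Lemma dot_unit k a b : unit_vec k a -> unit_vec k b -> -1 <= dot k a b <= 1.
Proof.
move=> ua ub; rewrite -ler_norml -(@ler_sqr _ `|_|) ?nnegrE// expr1n real_normK ?num_real//.
by have := cauchy_schwarz k a b; rewrite ua ub mulr1.
Qed.

(** Split a and c into their components along b and orthogonal to b; the
    orthogonal components have norms sin (angle a b) and sin (angle b c), so the
    claim is the Cauchy-Schwarz inequality for them. *)
Lemma angle_triangle k a b c : unit_vec k a -> unit_vec k b -> unit_vec k c ->
  acos (dot k a c) <= acos (dot k a b) + acos (dot k b c).
Proof.
move=> ua ub uc.
have hac := dot_unit ua uc; have hab := dot_unit ua ub; have hbc := dot_unit ub uc.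
have [h|h] := leP pi (acos (dot k a b) + acos (dot k b c)).
  exact: le_trans (acos_lepi hac) h.
apply: acos_le => //; first by rewrite addr_ge0 ?acos_ge0// ltW.
rewrite cosD !acosK ?in_itv// !sin_acos//.
set x := dot k a b; set y := dot k b c; set z := dot k a c.
have := cauchy_schwarz k (comb 1 a (- x) b) (comb 1 c (- y) b).
rewrite !(dot_combl, dot_combr) (dotC k b a) (dotC k c b) ua ub uc -/x -/y -/z.
rewrite (_ : 1 * (1 * 1 + - x * x) + - x * (1 * x + - x * 1) = 1 - x ^+ 2); last by ring.
rewrite (_ : 1 * (1 * 1 + - y * y) + - y * (1 * y + - y * 1) = 1 - y ^+ 2); last by ring.
rewrite (_ : 1 * (1 * z + - y * x) + - x * (1 * y + - y * 1) = z - x * y); last by ring.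
have x2 : 0 <= 1 - x ^+ 2.
  by rewrite subr_ge0 -[x ^+ 2]real_normK ?num_real// expr_le1// ler_norml.
have y2 : 0 <= 1 - y ^+ 2.
  by rewrite subr_ge0 -[y ^+ 2]real_normK ?num_real// expr_le1// ler_norml.
rewrite -ler_sqrt ?mulr_ge0// sqrtr_sqr sqrtrM// ler_norml => /andP[+ _].
lra.
Qed.

End SphericalDistance.

(** * Lifting the solid to the sphere *)

Section Lift.
Variables (R : realType) (d : nat) (rho : R).
Local Notation point := (pointX R d).
Local Notation solid := (solid rho).
Implicit Types (z w : point) (a : nat -> R) (f : point -> R).

(** Coefficient and exponents of a monomial; the exponent of index d is that of t. *)
Definition monomial := (R * (nat -> nat))%type.

Lemma polyval_terms (n : nat) f : PiE rho n f -> exists l : seq monomial,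
  (forall c, List.In c l -> (\sum_(i < d) c.2 i + c.2 d <= n)%N) /\
  forall z, f z =
    \sum_(c <- l) c.1 * (\prod_(i < d) tnth z.1 i ^+ c.2 i * z.2 ^+ c.2 d).
Proof.
move=> [_ [p [pn ->]]].
pose expo (m : mpoly.multinom d.+1) (i : nat) := mpoly.fun_of_multinom m (inord i).
exists [seq (mpoly.mcoeff m p, expo m) | m <- mpoly.msupp p]; split.
  have wid (i : 'I_d) : inord i = widen_ord (leqnSn d) i :> 'I_d.+1.
    by apply: val_inj; rewrite /= inordK// ltnS ltnW.
  have mx : inord d = ord_max :> 'I_d.+1 by apply: val_inj; rewrite /= inordK.
  move: (mpoly.msupp p) pn; elim=> [|m s IH] pn c //= [<-|]; last first.
    by apply: IH => m' ms; apply: pn; rewrite inE ms orbT.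
  apply: leq_trans (pn m _); last by rewrite inE eqxx.
  rewrite mpoly.mdegE big_ord_recr /= /expo mx leq_add2r.
  by under eq_bigr do rewrite wid.
move=> z; rewrite /polyval mpoly.mevalE [RHS]big_map; apply: eq_bigr => m _ /=.
congr (_ * _); rewrite big_ord_recr /=; congr (_ * _).
  apply: eq_bigr => i _; congr (_ ^+ _).
    by rewrite !(tnth_nth 0) /= nth_rcons size_tuple ltn_ord.
  rewrite /expo; congr mpoly.fun_of_multinom; apply: val_inj.
  by rewrite /= inordK// ltnS ltnW.
congr (_ ^+ _); first by rewrite (tnth_nth 0) /= nth_rcons size_tuple ltnn eqxx.
by rewrite /expo; congr mpoly.fun_of_multinom; apply: val_inj; rewrite /= inordK.
Qed.

(** The point of the unit sphere of R^(d+2) that realizes distX as the geodesic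
    distance. *)
Definition to_sphere z : nat -> R := fun i =>
  if (i < d)%N then nth 0 z.1 i
  else if i == d then Num.sqrt (z.2 ^+ 2 - rho ^+ 2 - inner z.1 z.1)
  else Num.sqrt (1 + rho ^+ 2 - z.2 ^+ 2).

Lemma dot_recr2 a b : dot d.+2 a b =
  \sum_(i < d) a i * b i + a d * b d + a d.+1 * b d.+1.
Proof. by rewrite /dot !big_ord_recr. Qed.

Lemma distX_to_sphere z w : distX rho z w = acos (dot d.+2 (to_sphere z) (to_sphere w)).
Proof.
rewrite /distX dot_recr2 /to_sphere ltnn eqxx ltnNge leqnSn/= (gtn_eqF (ltnSn d)).
congr (acos (_ + _ + _)); apply: eq_bigr => i _.
by rewrite ltn_ord !(tnth_nth 0).
Qed.

Lemma solid_bounds z : solid z ->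
  0 <= z.2 ^+ 2 - rho ^+ 2 - inner z.1 z.1 /\ 0 <= 1 + rho ^+ 2 - z.2 ^+ 2.
Proof.
move=> [h1 /andP[_ h2]]; split; first by rewrite subr_ge0.
have r0 : 0 <= rho ^+ 2 + 1 by rewrite addr_ge0// sqr_ge0.
rewrite subr_ge0 addrC -[X in _ <= X]sqr_sqrtr// -real_normK ?num_real//.
by rewrite ler_sqr ?nnegrE ?sqrtr_ge0.
Qed.

Lemma to_sphere_unit z : solid z -> unit_vec d.+2 (to_sphere z).
Proof.
move=> /solid_bounds[h1 h2]; rewrite /unit_vec dot_recr2.
rewrite /to_sphere ltnn eqxx ltnNge leqnSn/= (gtn_eqF (ltnSn d)) -!expr2 !sqr_sqrtr//.
rewrite (_ : \sum_(i < d) _ = inner z.1 z.1); first by ring.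
by apply: eq_bigr => i _; rewrite ltn_ord !(tnth_nth 0).
Qed.

(** A section of [to_sphere], up to the signs of the last two coordinates; s is
    the sign of t, which selects the part. *)
Definition of_sphere (s : R) a : point :=
  ([tuple a i | i < d], s * Num.sqrt (1 + rho ^+ 2 - a d.+1 ^+ 2)).

Lemma inner_of_sphere s a :
  inner (of_sphere s a).1 (of_sphere s a).1 = \sum_(i < d) a i * a i.
Proof. by apply: eq_bigr => i _; rewrite tnth_mktuple. Qed.

Lemma unit_sqr_le1 a : unit_vec d.+2 a -> a d.+1 ^+ 2 <= 1.
Proof.
rewrite /unit_vec dot_recr2 => <-; rewrite expr2 lerDr addr_ge0//.
  by apply: sumr_ge0 => i _; rewrite -expr2 sqr_ge0.
by rewrite -expr2 sqr_ge0.
Qed.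

Lemma of_sphere_sqr s a : s ^+ 2 = 1 -> unit_vec d.+2 a ->
  (of_sphere s a).2 ^+ 2 = 1 + rho ^+ 2 - a d.+1 ^+ 2.
Proof.
move=> s1 ua; rewrite exprMn s1 mul1r sqr_sqrtr//.
by have := unit_sqr_le1 ua; have := sqr_ge0 rho; lra.
Qed.

Lemma of_sphere_solid s a : 0 <= rho -> s ^+ 2 = 1 -> unit_vec d.+2 a ->
  solid (of_sphere s a).
Proof.
move=> r0 s1 ua; have e := of_sphere_sqr s1 ua; have l1 := unit_sqr_le1 ua.
have ua' := ua; rewrite /unit_vec dot_recr2 in ua'.
split; first by rewrite inner_of_sphere e; have := sqr_ge0 (a d); rewrite !expr2; lra.
have n2 : `|(of_sphere s a).2| ^+ 2 = 1 + rho ^+ 2 - a d.+1 ^+ 2.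
  by rewrite real_normK ?num_real.
apply/andP; split.
  by rewrite -ler_sqr ?nnegrE// n2; lra.
rewrite -ler_sqr ?nnegrE ?sqrtr_ge0// n2 sqr_sqrtr ?addr_ge0 ?sqr_ge0//.
by have := sqr_ge0 (a d.+1); lra.
Qed.

Lemma to_of_sphere s a : s ^+ 2 = 1 -> unit_vec d.+2 a ->
  [/\ forall i, (i < d)%N -> to_sphere (of_sphere s a) i = a i,
      to_sphere (of_sphere s a) d = `|a d| &
      to_sphere (of_sphere s a) d.+1 = `|a d.+1|].
Proof.
move=> s1 ua; have e := of_sphere_sqr s1 ua.
have ua' := ua; rewrite /unit_vec dot_recr2 in ua'.
split.
- move=> i id; rewrite /to_sphere id -(tnth_nth 0 _ (Ordinal id)).
  by rewrite tnth_mktuple.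
- rewrite /to_sphere ltnn eqxx e inner_of_sphere -sqrtr_sqr; congr Num.sqrt.
  by rewrite -ua' !expr2; ring.
- rewrite /to_sphere ltnNge leqnSn/= (gtn_eqF (ltnSn d)) e -sqrtr_sqr.
  by congr Num.sqrt; ring.
Qed.

(** Folding the sphere onto the quarter that contains the image of z only
    increases the scalar products with that image. *)
Lemma dist_of_sphere s a z : 0 <= rho -> s ^+ 2 = 1 -> unit_vec d.+2 a -> solid z ->
  distX rho z (of_sphere s a) <= acos (dot d.+2 (to_sphere z) a).
Proof.
move=> r0 s1 ua sz; rewrite distX_to_sphere.
have uz := to_sphere_unit sz; have up := to_sphere_unit (of_sphere_solid r0 s1 ua).
have h1 := dot_unit uz ua; have h2 := dot_unit uz up.
apply: acos_le; rewrite ?acos_ge0 ?acos_lepi// acosK ?in_itv//.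
have [e1 e2 e3] := to_of_sphere s1 ua.
rewrite !dot_recr2 e2 e3 lerD//; first rewrite lerD//.
- by apply: ler_sum => i _; rewrite e1.
- rewrite ler_wpM2l ?ler_norm//.
  by rewrite /to_sphere ltnn eqxx sqrtr_ge0.
- rewrite ler_wpM2l ?ler_norm//.
  by rewrite /to_sphere ltnNge leqnSn/= (gtn_eqF (ltnSn d)) sqrtr_ge0.
Qed.

(** The part of the polynomial that is even in t, with t^2 written in terms of the
    last coordinate on the sphere. *)
Definition eval_even (l : seq monomial) a : R := \sum_(c <- l | ~~ odd (c.2 d))
  c.1 * (\prod_(i < d) a i ^+ c.2 i * (1 + rho ^+ 2 - a d.+1 ^+ 2) ^+ (c.2 d)./2).

(** The odd powers of t cancel in the mean of f z and f (flip z). *)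
Lemma eval_even_to_sphere (n : nat) f (l : seq monomial) z : PiE rho n f ->
  (forall z, f z =
    \sum_(c <- l) c.1 * (\prod_(i < d) tnth z.1 i ^+ c.2 i * z.2 ^+ c.2 d)) ->
  solid z -> f z = eval_even l (to_sphere z).
Proof.
move=> [fe _] fl sz; have [_ h2] := solid_bounds sz.
have -> : f z = 2^-1 * (f z + f (flip z)) by rewrite -fe//; field.
rewrite !fl -big_split mulr_sumr /eval_even [RHS]big_mkcond /=.
apply: eq_bigr => c _; rewrite exprNn.
case: ifPn => [/negbTE oc|/negbNE oc]; last by rewrite -signr_odd oc; ring.
rewrite -signr_odd oc expr0 mul1r.
have -> : \prod_(i < d) to_sphere z i ^+ c.2 i = \prod_(i < d) tnth z.1 i ^+ c.2 i.
  by apply: eq_bigr => i _; rewrite /to_sphere ltn_ord (tnth_nth 0).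
have -> : 1 + rho ^+ 2 - to_sphere z d.+1 ^+ 2 = z.2 ^+ 2.
  rewrite /to_sphere ltnNge leqnSn/= (gtn_eqF (ltnSn d)) sqr_sqrtr//; ring.
by rewrite -exprM mul2n even_halfK ?oc//; field.
Qed.

Lemma eval_even_of_sphere s a l : s ^+ 2 = 1 -> unit_vec d.+2 a ->
  eval_even l (to_sphere (of_sphere s a)) = eval_even l a.
Proof.
move=> s1 ua; have [e1 e2 e3] := to_of_sphere s1 ua.
apply: eq_bigr => c _; rewrite e3 real_normK ?num_real//.
by congr (_ * (_ * _)); apply: eq_bigr => i _; rewrite e1.
Qed.

Lemma trigp_prod (k : nat) (e : nat -> nat) (F : nat -> R -> R) :
  (forall i, trigp (e i) (F i)) ->
  trigp (\sum_(i < k) e i) (fun t => \prod_(i < k) F i t).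
Proof.
move=> hF; elim: k => [|k IH].
  by rewrite big_ord0; apply: trigp_eq (trigp_cst _ 1) => t; rewrite big_ord0.
by rewrite big_ord_recr; apply: trigp_eq (trigpM IH (hF k)) => t; rewrite big_ord_recr.
Qed.

Lemma trigp_eval_even (n : nat) (l : seq monomial) a b :
  (forall c, List.In c l -> (\sum_(i < d) c.2 i + c.2 d <= n)%N) ->
  trigp n (fun t => eval_even l (comb (cos t) a (sin t) b)).
Proof.
move=> ln; rewrite /eval_even.
elim: l ln => [|c l IH] ln.
  by apply: trigp_eq (trigp_cst n 0) => t; rewrite big_nil.
have {}IH := IH (fun c' h => ln c' (or_intror h)).
have [oc|oc] := boolP (odd (c.2 d)).
  by apply: trigp_eq IH => t; rewrite big_cons oc.
have hc : trigp n (fun t => c.1 * (\prod_(i < d) comb (cos t) a (sin t) b i ^+ c.2 i *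
    (1 + rho ^+ 2 - comb (cos t) a (sin t) b d.+1 ^+ 2) ^+ (c.2 d)./2)).
  apply: trigpZ; apply: trigpW (ln c (or_introl erefl)) _; apply: trigpM.
    apply: (@trigp_prod d c.2 (fun i t => comb (cos t) a (sin t) b i ^+ c.2 i)) => i.
    by rewrite -[X in trigp X _]muln1; apply: trigpX; exact: trigp_line.
  have E : c.2 d = ((c.2 d)./2 * 2)%N by rewrite muln2 even_halfK.
  rewrite [X in trigp X _]E; apply: trigpX.
  have h2 := trigpZ (-1) (trigpX 2 (trigp_line (a d.+1) (b d.+1))).
  apply: trigp_eq (trigpD (trigp_cst 2 (1 + rho ^+ 2)) h2) => t.
  by rewrite /comb; ring.
by apply: trigp_eq (trigpD hc IH) => t; rewrite big_cons oc.
Qed.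

End Lift.

(** * The parts of the solid *)

Section Parts.
Variables (R : realType) (d : nat) (rho : R).
Hypothesis rho0 : 0 <= rho.
Local Notation point := (pointX R d).
Local Notation solid := (@solid R d rho).
Local Notation dist := (@distX R d rho).

Implicit Types (f : point -> R) (D : set point).

(** A set saturated for [same_part], on which the whole sphere can be projected.
    The empty set qualifies, so that the case rho = 0, in which the solid is a
    single part, is also described by two parts. *)
Definition is_part (P : set point) : Prop :=
  [/\ P `<=` solid,
      forall z w, P z -> solid w -> same_part rho z w <-> P w &
      forall z, P z -> exists2 s : R, s ^+ 2 = 1 &
        forall a, unit_vec d.+2 a -> P (of_sphere d rho s a)].

Lemma measurable_coord (i : 'I_d) :
  measurable_fun setT (fun z : point => tnth z.1 i : R).
Proof. exact: (measurableT_comp (measurable_tnth i) measurable_fst). Qed.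

Lemma measurable_height : measurable_fun setT (fun z : point => z.2 : R).
Proof. exact: measurable_snd. Qed.

Lemma measurable_inner (z : point) :
  measurable_fun setT (fun w : point => inner z.1 w.1).
Proof.
apply: measurable_sum => i; apply: measurable_funM => //.
exact: measurable_coord.
Qed.

Lemma measurable_sqnorm : measurable_fun setT (fun w : point => inner w.1 w.1).
Proof.
by apply: measurable_sum => i; apply: measurable_funM; exact: measurable_coord.
Qed.

Lemma measurable_halfspaces (s : R) : measurable [set z : point | 0 <= s * z.2].
Proof.
have := @measurable_fun_le _ _ _ setT (cst 0) (fun z : point => s * z.2).
rewrite setTI; apply=> //.
by apply: measurable_funM => //; exact: measurable_height.
Qed.

Lemma measurable_solid : measurable solid.
Proof.
have mh := measurable_height.
have mn : measurable_fun setT (fun z : point => `|z.2| : R).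
  by apply: measurableT_comp.
have m1 : measurable (setT `&` [set z : point | inner z.1 z.1 <= z.2 ^+ 2 - rho ^+ 2]).
  apply: measurable_fun_le => //; first exact: measurable_sqnorm.
  by apply: measurable_funB => //; exact: measurable_funX.
have m2 : measurable (setT `&` [set z : point | rho <= `|z.2|]).
  exact: measurable_fun_le.
have m3 : measurable (setT `&` [set z : point | `|z.2| <= Num.sqrt (rho ^+ 2 + 1)]).
  exact: measurable_fun_le.
rewrite !setTI in m1 m2 m3.
have -> : solid = [set z : point | inner z.1 z.1 <= z.2 ^+ 2 - rho ^+ 2] `&`
   ([set z : point | rho <= `|z.2|] `&`
    [set z : point | `|z.2| <= Num.sqrt (rho ^+ 2 + 1)]).
  apply/seteqP; split=> z /=.
    by move=> [h1 /andP[h2 h3]].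
  by move=> [h1 [h2 h3]]; split => //; apply/andP.
exact: measurableI m1 (measurableI _ _ m2 m3).
Qed.

Lemma measurable_sqrt_fun (g : point -> R) : measurable_fun setT g ->
  measurable_fun setT (fun z => Num.sqrt (g z)).
Proof.
move=> mg; apply: measurableT_comp mg; apply: continuous_measurable_fun.
exact: sqrt_continuous.
Qed.

Lemma dist_lepi z w : solid z -> solid w -> 0 <= dist z w <= pi.
Proof.
move=> sz sw; rewrite distX_to_sphere.
have h := dot_unit (to_sphere_unit sz) (to_sphere_unit sw).
by rewrite acos_ge0 ?acos_lepi.
Qed.

Lemma measurable_cball_part (P : set point) z r : P `<=` solid -> measurable P ->
  measurable (cball P dist z r).
Proof.
move=> Ps mP.
have [Pz|nPz] := pselect (P z); last first.
  by rewrite (_ : cball _ _ _ _ = set0)//; apply/seteqP; split => // w [].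
have [r0|r0] := ltP r 0.
  rewrite (_ : cball _ _ _ _ = set0)//; apply/seteqP; split => // w [_ Pw].
  by have /andP[h _] := dist_lepi (Ps z Pz) (Ps w Pw); rewrite leNgt (lt_le_trans r0).
have [rpi|rpi] := leP pi r.
  rewrite (_ : cball _ _ _ _ = P)//; apply/seteqP; split => [w []//|w Pw].
  have /andP[_ h] := dist_lepi (Ps z Pz) (Ps w Pw); split=> //.
  exact: le_trans h rpi.
pose c (w : point) := inner z.1 w.1
    + Num.sqrt (z.2 ^+ 2 - rho ^+ 2 - inner z.1 z.1)
      * Num.sqrt (w.2 ^+ 2 - rho ^+ 2 - inner w.1 w.1)
    + Num.sqrt (1 + rho ^+ 2 - z.2 ^+ 2) * Num.sqrt (1 + rho ^+ 2 - w.2 ^+ 2).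
have mh := measurable_height.
have mc : measurable_fun setT c.
  apply: measurable_funD; first apply: measurable_funD.
  - exact: measurable_inner.
  - apply: measurable_funM => //; apply: measurable_sqrt_fun.
    apply: measurable_funB; last exact: measurable_sqnorm.
    by apply: measurable_funB => //; exact: measurable_funX.
  - apply: measurable_funM => //; apply: measurable_sqrt_fun.
    by apply: measurable_funB => //; exact: measurable_funX.
have -> : cball P dist z r = P `&` [set w | cos r <= c w].
  apply/seteqP; split => w /=.
    move=> [_ Pw zw]; split=> //.
    have h := dot_unit (to_sphere_unit (Ps z Pz)) (to_sphere_unit (Ps w Pw)).
    have /andP[h1 h2] := dist_lepi (Ps z Pz) (Ps w Pw).
    have -> : c w = cos (dist z w).
      rewrite distX_to_sphere acosK ?in_itv//.
      rewrite dot_recr2 /to_sphere ltnn eqxx ltnNge leqnSn/= (gtn_eqF (ltnSn d)).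
      congr (_ + _ + _); apply: eq_bigr => i _.
      by rewrite ltn_ord !(tnth_nth 0).
    by rewrite leNgt ltr_cos ?in_itv/= ?h1 ?h2 ?r0 ?(ltW rpi)// -leNgt.
  move=> [Pw zw]; split=> //; rewrite /distX -/(c w).
  apply: acos_le => //; last by rewrite r0 ltW.
  have h := dot_unit (to_sphere_unit (Ps z Pz)) (to_sphere_unit (Ps w Pw)).
  rewrite (_ : c w = dot d.+2 (to_sphere rho z) (to_sphere rho w))//.
  rewrite dot_recr2 /to_sphere ltnn eqxx ltnNge leqnSn/= (gtn_eqF (ltnSn d)).
  congr (_ + _ + _); apply: eq_bigr => i _.
  by rewrite ltn_ord !(tnth_nth 0).
apply: measurable_fun_le => //; exact: measurable_funS mc.
Qed.

Lemma measurable_PiE (n : nat) f D : PiE rho n f -> measurable_fun D f.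
Proof.
move=> /polyval_terms[l [_ fl]]; apply: (@measurable_funS _ _ _ _ setT) => //.
rewrite (_ : f = fun z => \sum_(c <- l) c.1 *
    (\prod_(i < d) tnth z.1 i ^+ c.2 i * z.2 ^+ c.2 d)); last exact/funext.
apply: measurable_sum => c; apply: measurable_funM => //; apply: measurable_funM.
  by apply: measurable_prod => i _; apply: measurable_funX; exact: measurable_coord.
by apply: measurable_funX; exact: measurable_height.
Qed.

(** The coordinates on the sphere are at most 1 in absolute value. *)
Lemma PiE_bounded (n : nat) f : PiE rho n f ->
  exists B : R, forall z, solid z -> `|f z| <= B.
Proof.
move=> hf; have [l [_ fl]] := polyval_terms hf.
exists (\sum_(c <- l | ~~ odd (c.2 d)) `|c.1| * (1 + rho ^+ 2) ^+ (c.2 d)./2).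
move=> z sz; rewrite (eval_even_to_sphere hf fl sz).
apply: le_trans (ler_norm_sum _ _ _) _; apply: ler_sum => c _.
rewrite normrM ler_wpM2l// normrM normrX.
have u := to_sphere_unit sz; have l1 := unit_sqr_le1 u.
have r2 := sqr_ge0 rho; have a2 := sqr_ge0 (to_sphere rho z d.+1).
rewrite -[leRHS]mul1r; apply: ler_pM => //.
  rewrite normr_prod; apply: prodr_ile1 => i _; rewrite normr_ge0/= normrX.
  apply: exprn_ile1 => //; rewrite -(@ler_sqr _ _ 1) ?nnegrE// expr1n real_normK ?num_real//.
  move: u; rewrite /unit_vec /dot (bigD1 (widen_ord (leqW (leqnSn d)) i)) //= -expr2 => <-.
  by rewrite lerDl sumr_ge0// => j _; rewrite -expr2 sqr_ge0.
apply: lerXn2r; rewrite ?nnegrE ?addr_ge0//.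
by rewrite ger0_norm; lra.
Qed.

(** Restrict f to the great circle through z and w: this is a trigonometric
    polynomial of degree n, and by folding its values are values of f on P, at
    points whose distance to z is at most the arc length, so [trigp_osc] applies. *)
Lemma osc_part (k n : nat) f (P : set point) : is_part P -> PiE rho n f ->
  (0 < n)%N -> osc_bound P dist n%:R (osc_cst R k) (2 * k) f.
Proof.
move=> [Ps Psame Pproj] hf n0 z M Pz hM w Pw zw.
have [l [ln fl]] := polyval_terms hf.
have fE y : solid y -> f y = eval_even d rho l (to_sphere rho y).
  by move=> sy; exact: eval_even_to_sphere hf fl sy.
have sz := Ps z Pz; have sw := Ps w Pw.
have ua := to_sphere_unit sz; have ub := to_sphere_unit sw.
set a := to_sphere rho z in ua *; set b := to_sphere rho w in ub *.
have hab := dot_unit ua ub.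
have zwE : dist z w = acos (dot d.+2 a b) by rewrite distX_to_sphere.
set h := dist z w in zw zwE *.
have h0 : 0 <= h by rewrite zwE acos_ge0.
have ch : cos h = dot d.+2 a b by rewrite zwE acosK// in_itv.
have [s s1 hs] := Pproj z Pz.
have h1 : h <= 1.
  apply: le_trans zw; rewrite ler_peMl// ler1n//.
have [hz|hz] := eqVneq h 0.
  suff -> : f w = f z by rewrite subrr normr0 hz !(mulr0, mul0r).
  rewrite !fE// -/a -/b.
  have e0 : dot d.+2 (comb 1 a (-1) b) (comb 1 a (-1) b) = 0.
    rewrite !(dot_combl, dot_combr) (dotC _ b a) ua ub -ch hz cos0; ring.
  have ab i : (i < d.+2)%N -> b i = a i.
    by move=> id; have := dot_eq0 e0 id; rewrite /comb; lra.
  apply: eq_bigr => c _; rewrite ab//; congr (_ * (_ * _)).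
  by apply: eq_bigr => i _; rewrite ab// ltnS ltnW// ltnS ltnW.
have sh : 0 < sin h.
  apply: sin_gt0_pi; rewrite lt0r hz h0/=.
  by apply: le_lt_trans h1 _; have := @pi_ge2 R; lra.
pose e := comb (sin h)^-1 b (- (cos h / sin h)) a.
have ae : dot d.+2 a e = 0.
  by rewrite dot_combr ua -ch; field; rewrite gt_eqF.
have ee : unit_vec d.+2 e.
  rewrite /unit_vec !(dot_combl, dot_combr) (dotC _ b a) ua ub -ch.
  have := cos2Dsin2 h; move: (cos h) => C CS.
  rewrite (_ : _ + _ = (1 - C ^+ 2) / sin h ^+ 2); last by field; rewrite gt_eqF.
  by rewrite -CS addrC addKr divff// expf_neq0// gt_eqF.
(* the great circle from a at t = 0 to b at t = h *)
pose gam t := comb (cos t) a (sin t) e.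
have ug t : unit_vec d.+2 (gam t).
  rewrite /unit_vec (dot_combl _ _ a _ e) !(dot_combr _ _ a _ e) (dotC _ e a) ua ee ae.
  by rewrite -[RHS](cos2Dsin2 t); ring.
pose Tr t := eval_even d rho l (gam t).
have TrE t : Tr t = f (of_sphere d rho s (gam t)).
  by rewrite fE ?eval_even_of_sphere//; apply: Ps; exact: hs.
have M0 : 0 <= M.
  have := hM z Pz; rewrite distX_to_sphere ua acos1 mulr0 addr0 expr1n mulr1.
  exact: le_trans.
have hTr t : `|Tr t| <= M * (1 + n%:R * acos (cos t)) ^+ (2 * k).
  rewrite TrE; apply: le_trans (hM _ (hs _ (ug t))) _; rewrite ler_wpM2l//.
  have sp := Ps _ (hs _ (ug t)).
  have /andP[d0 _] := dist_lepi sz sp.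
  have dle := dist_of_sphere rho0 s1 (ug t) sz.
  have ct : 0 <= acos (cos t) by rewrite acos_ge0// cos_geN1 cos_le1.
  apply: lerXn2r; rewrite ?nnegrE ?addr_ge0 ?mulr_ge0//.
  rewrite lerD2l ler_wpM2l//; apply: le_trans dle _.
  by rewrite /gam (dot_combr _ _ a _ e) ua ae mulr0 addr0 mulr1.
have hT : trigp n Tr by exact: trigp_eval_even.
have := trigp_osc n0 hT hTr h0 zw.
have -> : Tr 0 = f z.
  rewrite fE// /Tr; apply: eq_bigr => c _; rewrite /gam /comb cos0 sin0.
  congr (_ * (_ * _)); last by rewrite mul1r mul0r addr0.
  by apply: eq_bigr => i _; rewrite mul1r mul0r addr0.
have -> : Tr h = f w.
  rewrite fE// /Tr.
  have gb i : gam h i = b i.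
    by rewrite /gam /e /comb; field; rewrite gt_eqF.
  by apply: eq_bigr => c _; rewrite gb; under eq_bigr do rewrite gb.
by rewrite mulrA.
Qed.

Lemma solid_parts : exists P Q : set point,
  [/\ is_part P, is_part Q, measurable P /\ measurable Q,
      solid = P `|` Q & P `&` Q = set0].
Proof.
have one2 : (1 : R) ^+ 2 = 1 by rewrite expr1n.
have mone2 : (-1 : R) ^+ 2 = 1 by rewrite sqrrN expr1n.
have [r0|r0] := eqVneq rho 0.
  exists solid, set0; split.
  - split=> // [z w sz sw|z sz]; first by split=> // _; left.
    by exists 1 => // a ua; exact: of_sphere_solid.
  - by split.
  - by split => //; exact: measurable_solid.
  - by rewrite setU0.
  - by rewrite setI0.
have rp : 0 < rho by rewrite lt0r r0.
have part (s : R) : s ^+ 2 = 1 -> is_part (solid `&` [set z | 0 <= s * z.2]).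
  move=> s1; have s0 : s != 0 by apply/eqP => s0; move: s1; rewrite s0 expr0n/=; lra.
  have spos z : solid z -> z.2 != 0.
    by move=> [_ /andP[h _]]; rewrite -normr_gt0 (lt_le_trans rp).
  have sE : s = 1 \/ s = -1.
    have : s ^+ 2 == 1 ^+ 2 by rewrite s1 one2.
    by rewrite eqf_sqr => /orP[/eqP|/eqP]; [left|right].
  split=> [z []//|z w [sz zp] sw|z [sz zp]].
    have zp' : 0 <= s * z.2 := zp.
    have /orP z0 : (z.2 < 0) || (0 < z.2) by rewrite -neq_lt; exact: spos.
    split=> [[/eqP|H]|[_ /= wp]]; first by rewrite (negbTE r0).
      split=> //=; case: sE => se; rewrite se ?mul1r ?mulN1r in zp' *;
        by case: H => -[h1 h2]; case: z0 => z0; lra.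
    by right; case: sE => se; rewrite se ?mul1r ?mulN1r in zp' wp;
      [left|right]; split; lra.
  exists s => // a ua; split; first exact: of_sphere_solid.
  by rewrite /= mulrA -expr2 s1 mul1r sqrtr_ge0.
exists (solid `&` [set z | 0 <= 1 * z.2]), (solid `&` [set z | 0 <= -1 * z.2]); split.
- exact: part.
- exact: part.
- by split; apply: measurableI; [exact: measurable_solid|exact: measurable_halfspaces|
    exact: measurable_solid|exact: measurable_halfspaces].
- rewrite -setIUr; apply/esym/setIidPl => z _ /=; rewrite mul1r mulN1r.
  by have [h|/ltW h] := leP 0 z.2; [left|right; lra].
- apply/seteqP; split=> // z [[[_ /andP[h _]] /= h1] [_ /= h2]].
  have z0 : z.2 = 0 by move: h1 h2; rewrite mul1r mulN1r; lra.
  by move: h; rewrite z0 normr0; lra.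
Qed.

End Parts.

(** * Discretization of the weighted norms *)

Section OnSolid.
Variables (R : realType) (d : nat) (rho : R).
Hypothesis rho0 : 0 <= rho.
Local Notation point := (pointX R d).
Local Notation solid := (@solid R d rho).
Local Notation dist := (@distX R d rho).
Implicit Types (W f : point -> R) (P Q Xi : set point).

(** [lebesgue_point] with its structure of measure. *)
Definition lebesgue_point_measure : {measure set point -> \bar R} :=
  product_measure1 (@lebesgue_tuple R d) (@lebesgue_measure R).

Local Notation mu := lebesgue_point_measure.

Lemma ballX_part P z r : is_part rho P -> P z -> ballX rho z r = cball P dist z r.
Proof.
move=> [Ps Psame _] Pz; apply/seteqP; split=> w.
  by move=> [sw [zw dw]]; split=> //; apply/(Psame z w).
by move=> [_ Pw dw]; split; [exact: Ps|split=> //; apply/(Psame z w) => //; exact: Ps].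
Qed.

Lemma doubling_space_part P W (L : R) (A : nat) : is_part rho P -> measurable P ->
  weightX rho W -> doubling rho L W -> L <= 2 ^+ A ->
  doubling_space mu P dist W A.
Proof.
move=> hP mP [mW W0] hL LA; have [Ps Psame _] := hP.
have u z : P z -> unit_vec d.+2 (to_sphere rho z) by move=> /Ps; exact: to_sphere_unit.
split=> //.
- by move=> z r; exact: measurable_cball_part.
- by move=> z w Pz Pw; have /andP[] := dist_lepi (Ps z Pz) (Ps w Pw).
- by move=> z Pz; rewrite distX_to_sphere u// acos1.
- by move=> z w Pz Pw; rewrite !distX_to_sphere dotC.
- by move=> z y w Pz Py Pw; rewrite !distX_to_sphere; apply: angle_triangle; exact: u.
- move=> z w Pz Pw; have /andP[_ h] := dist_lepi (Ps z Pz) (Ps w Pw).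
  by apply: le_trans h _; have := @pihalf_lt2 R; lra.
- exact: (measurable_funS (measurable_solid rho) Ps mW).
- by move=> z /Ps/W0.
- move=> z r Pz r0; have := hL z r (Ps z Pz) r0.
  rewrite /weight_of !(ballX_part _ hP Pz) => /le_trans; apply.
  rewrite lee_wpmul2r ?lee_fin//.
  by apply: integral_ge0 => x [_ /Ps/W0]; rewrite lee_fin.
Qed.

Lemma wnormX (p : R) W f : 0 < p -> weightX rho W ->
  (wnorm rho p W f `^ p = \int[mu]_(z in solid) (`|f z| `^ p * W z)%:E)%E.
Proof.
move=> p0 [_ W0]; rewrite /wnorm -poweRrM mulVf ?gt_eqF// poweRe1//.
by apply: integral_ge0 => x /W0 Wx; rewrite lee_fin mulr_ge0 ?powR_ge0.
Qed.

Lemma wnormX_parts (p : R) (n : nat) W f P Q : 0 < p -> weightX rho W -> PiE rho n f ->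
  measurable P -> measurable Q -> solid = P `|` Q -> P `&` Q = set0 ->
  (wnorm rho p W f `^ p = \int[mu]_(z in P) (`|f z| `^ p * W z)%:E +
     \int[mu]_(z in Q) (`|f z| `^ p * W z)%:E)%E.
Proof.
move=> p0 hW hf mP mQ PQ PQ0; rewrite wnormX// PQ ge0_integral_setU//.
- rewrite -PQ; apply/measurable_EFinP; apply: measurable_funM; last by case: hW.
  apply: (measurableT_comp (f := fun x => x `^ p)); first exact: measurable_powR.
  by apply: measurableT_comp => //; exact: measurable_PiE hf.
- rewrite -PQ => x sx; rewrite lee_fin mulr_ge0 ?powR_ge0//.
  by case: hW => _; apply.
- exact/eqP.
Qed.

Lemma esum_parts Xi P Q (a : point -> \bar R) : Xi `<=` solid ->
  solid = P `|` Q -> P `&` Q = set0 -> (forall z, Xi z -> 0 <= a z)%E ->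
  (\esum_(z in Xi) a z = \esum_(z in Xi `&` P) a z + \esum_(z in Xi `&` Q) a z)%E.
Proof.
move=> Xis PQ PQ0 a0; rewrite (esumID P)//; congr (_ + esum _ _)%E.
apply/seteqP; split=> z [Xz Pz]; split=> //.
  by have := Xis z Xz; rewrite PQ => -[].
by move=> Pz'; have : (P `&` Q) z by []; rewrite PQ0.
Qed.

(** Half of the exponent b of the Peetre majorants: large enough for all p at
    least 1 / j.+1, see [peetre_order_large]. *)
Definition peetre_order (A j : nat) : nat := (A.+1 * j.+1)%N.

Lemma peetre_order_large (A j : nat) (p : R) : 1 <= p * j.+1%:R ->
  A.+1%:R <= (2 * peetre_order A j)%:R * p.
Proof.
move=> pj; rewrite /peetre_order !natrM.
have : A.+1%:R * 1 <= A.+1%:R * (p * j.+1%:R) :> R by rewrite ler_wpM2l.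
have : 0 <= A.+1%:R * (p * j.+1%:R) :> R by rewrite mulr_ge0// (le_trans ler01).
by lra.
Qed.

Lemma exp2_le_powR (N j : nat) (p : R) : 1 <= p * j.+1%:R ->
  2 ^+ N <= (2 ^+ (N * j.+1)) `^ p.
Proof.
move=> pj; rewrite -!powR_mulrn// -powRrM; apply: ler_powR; first by rewrite ler1n.
by rewrite natrM -mulrA ler_peMr// mulrC.
Qed.

Lemma exp2_ge (x : R) : exists k : nat, x <= 2 ^+ k.
Proof.
have [x0|/ltW x0] := leP 0 x; last by exists 0%N; rewrite expr0; lra.
by have [k [h _ _]] := dyadic_scale x0; exists k.
Qed.

Lemma upper_on_solid (A j q sK : nat) (L p : R) (n m : nat) (delta : R) W Xi f :
  1 <= p * j.+1%:R -> 0 < p -> L <= 2 ^+ A ->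
  4 * osc_cst R (peetre_order A j) <= 2 ^+ sK ->
  weightX rho W -> doubling rho L W -> (0 < n)%N -> (n <= m)%N -> 0 < delta <= 1 ->
  (m%:R : R) <= 2 ^+ q * n%:R -> separatedX rho (delta / n%:R) Xi -> PiE rho m f ->
  (\esum_(z in Xi) (max_ball rho p f z (delta / n%:R)
                    * weight_of W (ballX rho z (delta / n%:R)))
   <= ((4 * (1 + 2 ^+ q) ^+ (2 * peetre_order A j)) `^ p *
        2 ^+ (A.+1 + A * (sK + 2) + A * (q + 4) + 1))%:E * (wnorm rho p W f) `^ p)%E.
Proof.
move=> pj p0 LA hs hW hL n0 nm /andP[d0 d1] mq [Xis Xisep] hf.
have [P [Q [hP hQ [mP mQ] PQ PQ0]]] := solid_parts d rho0.
have m0 : (0 < m)%N by exact: leq_trans nm.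
have mR : 0 < m%:R :> R by rewrite ltr0n.
have nR : 0 < n%:R :> R by rewrite ltr0n.
set e := delta / n%:R in Xisep *.
have e0 : 0 < e by rewrite divr_gt0.
have eq : e <= 2 ^+ q / m%:R.
  rewrite ler_pdivlMr// /e mulrAC ler_pdivrMr//.
  by apply: le_trans mq; rewrite ler_piMl// ltW.
set c := (X in (X%:E * _)%E).
have c0 : 0 <= c by rewrite mulr_ge0 ?powR_ge0 ?exprn_ge0.
have [B hB] := PiE_bounded hf.
have part S : is_part rho S -> measurable S ->
    (\esum_(z in Xi `&` S) (max_ball rho p f z e * weight_of W (ballX rho z e)) <=
     c%:E * \int[mu]_(z in S) (`|f z| `^ p * W z)%:E)%E.
  move=> hS mS; have [Ss Ssame _] := hS.
  have ds := doubling_space_part hS mS hW hL LA.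
  have sep z w : (Xi `&` S) z -> (Xi `&` S) w -> z <> w -> e <= dist z w.
    move=> [Xz Sz] [Xw Sw] zw; apply: Xisep => //.
    by apply/(Ssame z w) => //; exact: Ss.
  have := mz_upper ds (@measurable_PiE _ _ _ _ _ S hf) (fun w Sw => hB w (Ss w Sw)) p0 mR
    (osc_part rho0 (k := peetre_order A j) hS hf m0) (osc_cst_ge0 R _) hs (peetre_order_large _ pj)
    e0 eq (@subIsetr _ Xi S) sep.
  apply: le_trans; apply: le_esum => z [Xz Sz].
  by rewrite /max_ball /weight_of (ballX_part _ hS Sz).
rewrite (wnormX_parts p0 hW hf mP mQ PQ PQ0) (esum_parts Xis PQ PQ0).
  rewrite ge0_muleDr; [exact: leeD (part P hP mP) (part Q hQ mQ)|..].
    apply: integral_ge0 => z Pz; rewrite lee_fin mulr_ge0 ?powR_ge0//.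
    by case: hW => _; apply; rewrite PQ; left.
  apply: integral_ge0 => z Pz; rewrite lee_fin mulr_ge0 ?powR_ge0//.
  by case: hW => _; apply; rewrite PQ; right.
move=> z Xz; rewrite mule_ge0//.
  apply: (@le_trans _ _ (`|f z| `^ p)%:E); first by rewrite lee_fin powR_ge0.
  apply: ereal_sup_ubound; exists z => //; have sz := Xis z Xz.
  split=> //; split; last by rewrite distX_to_sphere to_sphere_unit// acos1 ltW.
  by right; have [h|/ltW h] := leP 0 z.2; [left|right].
by apply: integral_ge0 => w [sw _]; rewrite lee_fin; case: hW => _; apply.
Qed.

Lemma maximal_cover (e : R) Xi w : maximalX rho e Xi -> solid w ->
  exists2 z, Xi z & ballX rho z e w.
Proof.
move=> [c _ h] sw; have /andP[h1 _] := h w sw.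
apply: contrapT => nz; move: h1; rewrite esum1 ?lee_fin ?ler10// => z Xz.
by rewrite indicE memNset// => zw; apply: nz; exists z.
Qed.

Lemma lower_on_solid (A j sK : nat) (L p : R) (n : nat) (delta : R) W Xi f :
  1 <= p * j.+1%:R -> 0 < p -> L <= 2 ^+ A ->
  4 * osc_cst R (peetre_order A j) <= 2 ^+ sK ->
  16 * osc_cst R (peetre_order A j) * delta <= 1 ->
  (16 * osc_cst R (peetre_order A j) * delta) `^ p *
    2 ^+ (A.+1 + A * (sK + 2) + A * (0 + 4) + 1) <= 2^-1 ->
  weightX rho W -> doubling rho L W -> (0 < n)%N -> 0 < delta <= 1 ->
  separatedX rho (delta / n%:R) Xi -> maximalX rho (delta / n%:R) Xi ->
  PiE rho n f ->
  ((wnorm rho p W f) `^ p <= (2 * 2 `^ p)%:E *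
    \esum_(z in Xi) (min_ball rho p f z (delta / n%:R)
                     * weight_of W (ballX rho z (delta / n%:R))))%E.
Proof.
move=> pj p0 LA hs small1 small2 hW hL n0 /andP[d0 d1] [Xis Xisep] Ximax hf.
have [P [Q [hP hQ [mP mQ] PQ PQ0]]] := solid_parts d rho0.
have nR : 0 < n%:R :> R by rewrite ltr0n.
set e := delta / n%:R in Xisep Ximax *.
have e0 : 0 < e by rewrite divr_gt0.
have ne : n%:R * e <= delta by rewrite /e mulrC divfK ?gt_eqF.
have [B hB] := PiE_bounded hf.
have part S : is_part rho S -> measurable S ->
    (\int[mu]_(z in S) (`|f z| `^ p * W z)%:E <= (2 * 2 `^ p)%:E *
     \esum_(z in Xi `&` S) (min_ball rho p f z e * weight_of W (ballX rho z e)))%E.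
  move=> hS mS; have [Ss Ssame _] := hS.
  have ds := doubling_space_part hS mS hW hL LA.
  have sep z w : (Xi `&` S) z -> (Xi `&` S) w -> z <> w -> e <= dist z w.
    move=> [Xz Sz] [Xw Sw] zw; apply: Xisep => //.
    by apply/(Ssame z w) => //; exact: Ss.
  have cov w : S w -> exists2 z, (Xi `&` S) z & cball S dist z e w.
    move=> Sw; have [z Xz zw] := maximal_cover Ximax (Ss w Sw).
    have Sz : S z.
      apply/(Ssame w z) => //; first exact: Xis.
      case: zw => _ [+ _]; rewrite /same_part => -[->|[[h1 h2]|[h1 h2]]].
      - by left.
      - by right; left.
      - by right; right.
    by exists z; rewrite // -(ballX_part _ hS Sz).
  have := mz_lower ds (@measurable_PiE _ _ _ _ _ S hf) (fun w Sw => hB w (Ss w Sw)) p0 nR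
    (osc_part rho0 (k := peetre_order A j) hS hf n0) (osc_cst_ge0 R _) hs (peetre_order_large _ pj)
    e0 ne d1 (@subIsetr _ Xi S) sep cov small1 small2.
  move/le_trans; apply; rewrite lee_wpmul2l ?lee_fin ?mulr_ge0 ?powR_ge0//.
  apply: le_esum => z [Xz Sz].
  by rewrite /min_ball /weight_of (ballX_part _ hS Sz).
have t0 z : (0 <= min_ball rho p f z e * weight_of W (ballX rho z e))%E.
  rewrite mule_ge0//; first by apply: le_ereal_inf_tmp => _ [w _ <-]; rewrite lee_fin powR_ge0.
  by apply: integral_ge0 => w [sw _]; rewrite lee_fin; case: hW => _; apply.
rewrite (wnormX_parts p0 hW hf mP mQ PQ PQ0) (esum_parts Xis PQ PQ0)//.
rewrite ge0_muleDr ?esum_ge0//.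
exact: leeD (part P hP mP) (part Q hQ mQ).
Qed.

End OnSolid.

Theorem theorem4p16 (R : realType) (d : nat) (rho : R)
    (hd : (2 <= d)%N) (hrho : 0 <= rho) :
  (* (i); the middle clause says that the p-th root of cW p depends on p only
     when p is close to 0 *)
  (forall c L : R, 0 < c -> 0 < L ->
    exists cW : R -> R, [/\ forall p, 0 < p -> 0 < cW p,
      forall p0, 0 < p0 ->
        exists2 C : R, 0 < C & forall p, p0 <= p -> cW p <= C `^ p &
      forall W : pointX R d -> R,
        weightX rho W -> doubling rho L W -> even_on_solid rho W ->
      forall (n : nat) (delta : R), (0 < n)%N -> 0 < delta <= 1 ->
      forall Xi : set (pointX R d),
        separatedX rho (delta / n%:R) Xi -> maximalX rho (delta / n%:R) Xi ->
        symmetric_set Xi ->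
      forall (p : R) (m : nat) (f : pointX R d -> R),
        0 < p -> (n <= m)%N -> m%:R <= c * n%:R -> PiE rho m f ->
        (\esum_(z in Xi) (max_ball rho p f z (delta / n%:R)
                          * weight_of W (ballX rho z (delta / n%:R)))
         <= (cW p)%:E * (wnorm rho p W f) `^ p)%E]) /\
  (* (ii); the constant is C ^ p, with C depending on L and r only *)
  (forall L r : R, 0 < L -> 0 < r < 1 ->
    exists delta_r C : R, [/\ 0 < delta_r, 0 < C &
      forall W : pointX R d -> R,
        weightX rho W -> doubling rho L W -> even_on_solid rho W ->
      forall (n : nat) (delta : R), (0 < n)%N -> 0 < delta <= 1 ->
        delta <= delta_r ->
      forall Xi : set (pointX R d),
        separatedX rho (delta / n%:R) Xi -> maximalX rho (delta / n%:R) Xi ->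
        symmetric_set Xi ->
      forall (p : R) (f : pointX R d -> R),
        r <= p -> PiE rho n f ->
        ((wnorm rho p W f) `^ p
         <= (C `^ p)%:E
            * \esum_(z in Xi) (min_ball rho p f z (delta / n%:R)
                               * weight_of W (ballX rho z (delta / n%:R))))%E]).
Proof.
have pj (p : R) : 0 < p -> 1 <= p * (Num.truncn p^-1).+1%:R.
  move=> p0; rewrite -ler_pdivrMl// mulr1.
  by apply: ltW; exact: truncnS_gt.
split.
- move=> c L c0 L0.
  have [A LA] := exp2_ge L; have [q cq] := exp2_ge c.
  have /choice[sK hsK] j := exp2_ge (4 * osc_cst R (peetre_order A j)).
  pose N j := (A.+1 + A * (sK j + 2) + A * (q + 4) + 1)%N.
  pose Cst j : R := 4 * (1 + 2 ^+ q) ^+ (2 * peetre_order A j) * 2 ^+ (N j * j.+1).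
  have Cst0 j : 0 < Cst j.
    have q0 : 0 < 1 + 2 ^+ q :> R by rewrite addr_gt0// exprn_gt0.
    by rewrite !mulr_gt0// exprn_gt0.
  (* the constant is locally constant in p: only the least j with 1 / j.+1 < p
     matters, so it is bounded for p away from 0 *)
  exists (fun p => Cst (Num.truncn p^-1) `^ p); split.
  + by move=> p p0; exact: powR_gt0.
  + move=> p0 p00; exists (\sum_(j < (Num.truncn p0^-1).+1) Cst j).
      rewrite big_ord_recl ltr_wpDr ?Cst0//.
      by apply: sumr_ge0 => i _; exact/ltW/Cst0.
    move=> p pp0; have p1 : 0 < p by exact: lt_le_trans pp0.
    have jj : (Num.truncn p^-1 < (Num.truncn p0^-1).+1)%N.
      by rewrite ltnS; apply: le_truncn; rewrite lef_pV2.
    apply: ge0_ler_powR; rewrite ?nnegrE ?(ltW p1) ?(ltW (Cst0 _))//.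
      by apply: sumr_ge0 => i _; exact/ltW/Cst0.
    rewrite (bigD1 (Ordinal jj))//= lerDl.
    by apply: sumr_ge0 => i _; exact/ltW/Cst0.
  + move=> W hW hL _ n delta n0 hd1 Xi Xisep _ _ p m f p0 nm mc hf.
    have pj1 := pj p p0; set j := Num.truncn p^-1 in pj1 *.
    have mq : (m%:R : R) <= 2 ^+ q * n%:R by apply: le_trans mc _; rewrite ler_wpM2r.
    apply: le_trans (upper_on_solid hrho pj1 p0 LA (hsK j) hW hL n0 nm hd1 mq Xisep hf) _.
    have a0 : 0 <= 4 * (1 + 2 ^+ q) ^+ (2 * peetre_order A j) :> R.
      by rewrite mulr_ge0// exprn_ge0// addr_ge0// exprn_ge0.
    have b0 : 0 <= 2 ^+ (N j * j.+1) :> R by rewrite exprn_ge0.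
    rewrite lee_wpmul2r ?poweR_ge0// lee_fin -/(N j) /Cst (powRM _ a0 b0).
    by rewrite ler_wpM2l ?powR_ge0//; exact: exp2_le_powR.
- move=> L r L0 /andP[r0 r1].
  have [A LA] := exp2_ge L; pose j := Num.truncn r^-1.
  have [sK hsK] := exp2_ge (4 * osc_cst R (peetre_order A j)).
  pose N := (A.+1 + A * (sK + 2) + A * (0 + 4) + 1)%N.
  pose K := osc_cst R (peetre_order A j).
  have K0 : 0 <= K := osc_cst_ge0 R _.
  (* eta is chosen so that eta^p 2^N <= 1 / 2 for all p >= 1 / j.+1 *)
  pose eta : R := (2 ^+ (N.+1 * j.+1))^-1.
  have eta0 : 0 < eta by rewrite invr_gt0 exprn_gt0.
  have K1 : 0 < 16 * K + 1 by rewrite ltr_wpDl// mulr_ge0.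
  exists (eta / (16 * K + 1)), (2 ^+ (1 * j.+1) * 2); split.
  + by rewrite divr_gt0.
  + by rewrite mulr_gt0// exprn_gt0.
  + move=> W hW hL _ n delta n0 hd1 dsmall Xi Xisep Ximax _ p f rp hf.
    have p0 : 0 < p by exact: lt_le_trans rp.
    have d0 : 0 < delta by case/andP: hd1.
    have pj1 : 1 <= p * j.+1%:R by apply: (le_trans (pj r r0)); rewrite ler_wpM2r.
    have Kd : 16 * K * delta <= eta.
      move: dsmall; rewrite ler_pdivlMr//; apply: le_trans.
      by rewrite mulrC ler_wpM2l ?(ltW d0)// lerDl.
    have Kd0 : 0 <= 16 * K * delta by rewrite !mulr_ge0// ltW.
    have eta1 : eta <= 1 by rewrite invf_le1 ?exprn_gt0// exprn_ege1// ler1n.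
    have small : (16 * K * delta) `^ p * 2 ^+ N <= 2^-1.
      apply: (@le_trans _ _ (eta `^ p * 2 ^+ N)).
        rewrite ler_wpM2r ?exprn_ge0//.
        by apply: ge0_ler_powR; rewrite ?nnegrE ?(ltW p0) ?(ltW eta0).
      rewrite -ler_pdivlMr ?exprn_gt0// -invfM -exprS.
      have -> : eta `^ p = ((2 ^+ (N.+1 * j.+1)) `^ p)^-1.
        by rewrite /eta -powR_inv1 ?exprn_ge0// -powRrM mulN1r powRN.
      rewrite lef_pV2 ?posrE ?powR_gt0 ?exprn_gt0//; exact: exp2_le_powR.
    apply: le_trans (lower_on_solid hrho pj1 p0 LA hsK (le_trans Kd eta1) small hW hL
      n0 hd1 Xisep Ximax hf) _.
    rewrite lee_wpmul2r//.
      apply: esum_ge0 => z _; rewrite mule_ge0//.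
        by apply: le_ereal_inf_tmp => _ [w _ <-]; rewrite lee_fin powR_ge0.
      by apply: integral_ge0 => w [sw _]; rewrite lee_fin; case: hW => _; apply.
    rewrite lee_fin powRM ?exprn_ge0// ler_wpM2r ?powR_ge0//.
    by rewrite -[X in X <= _]expr1; exact: exp2_le_powR.
Qed.
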